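(* Let $\alpha=1$, $x_0\in\mathbb{R}$, $r>0$ and $D=(x_0-r,x_0+r)$. Then $\mu_{1,D}=2\sqrt{2}/(\pi\sqrt{r})$. For $\lambda=\mu_{1,D}$ the interior Bernoulli problem with one free boundary point on $D$ has exactly one solution $(u,K)$, given by $$K=(x_0,x_0+r),\qquad u(x)=\frac{2}{\pi}\arctan\left(\frac{(x-x_0+r)^{1/2}}{(2(x_0-x))^{1/2}}\right),\quad x\in D\setminus\overline{K}.$$ For $\lambda>\mu_{1,D}$ it has exactly two solutions $(u_1,K_1)$ and $(u_2,K_2)$, given by $$K_i=(a_i,x_0+r),\qquad u_i(x)=\frac{2}{\pi}\arctan\left(\frac{(x-x_0+r)^{1/2}(x_0+r-a_i)^{1/2}}{(a_i-x)^{1/2}(2r)^{1/2}}\right),\quad x\in D\setminus\overline{K_i},$$ where $a_i=x_0+(-1)^i\, r\,(1-\mu_{1,D}^2/\lambda^2)^{1/2}$ for $i=1,2$.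
   Context: For $\alpha=1$ the fractional Laplacian on $\mathbb{R}$ is $$(-\Delta)^{1/2}f(x) = \lim_{\varepsilon \to 0^+} \frac{1}{\pi}\int_{\{z\in\mathbb{R}:\,|z|>\varepsilon\}}\frac{f(x+z)-f(x)}{|z|^{2}}\,dz .$$ Interior Bernoulli problem with one free boundary point ($\alpha=1$): given $x_0\in\mathbb{R}$, $r>0$, $D=(x_0-r,x_0+r)$ and a constant $\lambda>0$, a solution is a pair $(u,K)$ where $u:\mathbb{R}\to[0,1]$ is Borel measurable and continuous in $D$, and $K=(a,x_0+r)\subset D$ is an interval, such that $(-\Delta)^{1/2}u(x)=0$ for $x\in D\setminus\overline{K}$; $u(x)=1$ for $x\in\overline{K}\setminus\{x_0+r\}$; $u(x)=0$ for $x\in D^c=\mathbb{R}\setminus D$; $D_n^{1/2}u(a)=-\lambda$, where $D_n^{1/2}u(a)=\lim_{t\to0^+}\frac{u(a-t)-u(a)}{t^{1/2}}$. The constant $\mu_{1,D}>0$ is the (unique) constant such that this problem has exactly two solutions for $\lambda>\mu_{1,D}$, exactly one solution for $\lambda=\mu_{1,D}$ and no solution for $0<\lambda<\mu_{1,D}$. Outside $D\setminus\overline{K}$ the values of $u$ are prescribed by the problem, so the formulas on $D\setminus\overline{K}$ determine $u$. *)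

(* Defs.v *)
From HB Require Import structures.
From mathcomp Require Export all_boot all_order all_algebra.
From mathcomp Require Export all_classical all_reals all_analysis.
Export Order.TTheory GRing.Theory Num.Theory.
Export numFieldNormedType.Exports.

Set Implicit Arguments.
Unset Strict Implicit.
Unset Printing Implicit Defensive.

Local Open Scope classical_set_scope.
Local Open Scope ring_scope.

(* The integral is extended-real valued, so convergence to the finite value
   l%:E also forces the integrals for small e to be finite. *)
Definition half_laplacian_is (R : realType) (f : R -> R) (x l : R) : Prop :=
  ((pi^-1)%:E * \int[@lebesgue_measure R]_(z in [set z : R | (e < `|z|)%R])
      ((f (x + z)%R - f x) / `|z| ^+ 2)%R%:E)%E @[e --> 0^'+] --> l%:E.

Definition half_normal_derivative_is (R : realType) (f : R -> R) (a l : R)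
    : Prop :=
  (f (a - t) - f a) / Num.sqrt t @[t --> 0^'+] --> l.

(* a < x0 + r says that K is a nondegenerate interval; x0 - r <= a is then
   equivalent to K `<=` D. *)
Definition bernoulli_solution (R : realType) (x0 r lambda : R)
    (u : R -> R) (K : set R) : Prop :=
  let D : set R := `]x0 - r, x0 + r[%classic in
  [/\ measurable_fun [set: R] u,
      forall x, 0 <= u x <= 1,
      {within D, continuous u} &
      exists a : R,
        [/\ a < x0 + r, K = `]a, x0 + r[%classic & K `<=` D] /\
        [/\ forall x, (D `\` closure K) x -> half_laplacian_is u x 0,
            forall x, (closure K `\ (x0 + r)) x -> u x = 1,
            forall x, (~` D) x -> u x = 0 &
            half_normal_derivative_is u a (- lambda)]].

Definition bernoulli_solutions (R : realType) (x0 r lambda : R)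
    : set ((R -> R) * set R) :=
  [set p | bernoulli_solution x0 r lambda p.1 p.2].

Definition is_bernoulli_constant (R : realType) (x0 r mu : R) : Prop :=
  [/\ 0 < mu,
      forall lambda, mu < lambda ->
        (bernoulli_solutions x0 r lambda #= `I_2)%card,
      (bernoulli_solutions x0 r mu #= `I_1)%card &
      forall lambda, 0 < lambda < mu ->
        bernoulli_solutions x0 r lambda = set0].

(* Main.v *)
(** The explicit functions come from one profile on [(b, a)], a rescaled arctangent
    whose half-Laplacian at [x] is [1 / (pi (c - x))] for a pole [c] outside
    [[b, a]]: integration by parts turns the singular quotient into
    [profile' y / (y - x)] with
    [profile' y = const / ((c - y) sqrt (y - b) sqrt (a - y))], which has an
    elementary primitive.  A unit jump at [c] contributes exactly the opposite,
    so subtracting it gives the solution with data [1] on [[a, c)] and [0] on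
    the rest of the complement of [(b, a)].

    For fixed [a], uniqueness follows from the maximum principle.  The
    difference of two solutions may jump at [b]; it is compared with the solution
    on [(d, a)] with data [1] on [(b, d]] (same profile, pole [b] on the left),
    which tends to [0] as [d] tends to [b].  The free-boundary condition then reads
    [lambda^2 (r^2 - (a - x0)^2) = mu^2 r^2], a quadratic equation in [a]. *)

Require Import Defs.
From mathcomp Require Import measurable_realfun ring lra.

Set Implicit Arguments.
Unset Strict Implicit.
Unset Printing Implicit Defensive.

Local Open Scope classical_set_scope.
Local Open Scope ring_scope.

(** * Derivative rules for functions given pointwise *)

Section RealDerive.
Context {R : realType}.
Implicit Types (f g : R -> R) (x a b : R).

Lemma is_derive1D f g x a b : is_derive x 1 f a -> is_derive x 1 g b ->
  is_derive x 1 (fun y => f y + g y) (a + b).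
Proof. by move=> df dg; exact: (is_deriveD df dg). Qed.

Lemma is_derive1N f x a : is_derive x 1 f a ->
  is_derive x 1 (fun y => - f y) (- a).
Proof. by move=> df; exact: (is_deriveN df). Qed.

Lemma is_derive1M f g x a b : is_derive x 1 f a -> is_derive x 1 g b ->
  is_derive x 1 (fun y => f y * g y) (a * g x + f x * b).
Proof.
move=> df dg; have H := is_deriveM df dg.
apply: (is_derive_eq H); rewrite /GRing.scale/=; ring.
Qed.

Lemma is_derive1V f x a : f x != 0 -> is_derive x 1 f a ->
  is_derive x 1 (fun y => (f y)^-1) (- a / f x ^+ 2).
Proof.
move=> f0 df; have H := is_deriveV f0 df.
by apply: (is_derive_eq H); rewrite /GRing.scale/= mulNr mulrC mulNr.
Qed.

Lemma is_derive1_chain f g x a b : is_derive (g x) 1 f a ->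
  is_derive x 1 g b -> is_derive x 1 (fun y => f (g y)) (a * b).
Proof. by move=> df dg; exact: (is_derive1_comp (f := f) (g := g)). Qed.

Lemma is_derive1_cst x a : is_derive x 1 (fun _ : R => a) 0.
Proof. exact: is_derive_cst. Qed.

Lemma is_derive1_shift x a : is_derive x 1 (fun y : R => a + y) 1.
Proof.
have H := @is_derive1D (fun=> a) id x 0 1 (is_derive1_cst x a) (is_derive_id x 1).
by apply: (is_derive_eq H); rewrite add0r.
Qed.

End RealDerive.

(** * Integrals of the inverse square over rays *)

Lemma continuous_inv_sqr (R : realType) (z : R) : z != 0 ->
  {for z, continuous (fun z : R => `|z| ^- 2)}.
Proof.
move=> z0; apply: continuousV; first by rewrite expf_neq0// normr_eq0.
apply: (@continuous_comp _ _ _ (fun y : R => `|y|) (fun y : R => y ^+ 2)).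
  exact: norm_continuous.
exact: exprn_continuous.
Qed.

Lemma integral_inv_sqr_ray (R : realType) (s : R) : 0 < s ->
  (\int[@lebesgue_measure R]_(z in `[s, +oo[) (`|z| ^- 2)%:E = (s^-1)%:E)%E.
Proof.
move=> s0.
have dF (x : R) : 0 < x -> is_derive x 1 (fun z : R => - z^-1) (`|x| ^- 2).
  move=> x0; have xn0 : x != 0 by rewrite gt_eqF.
  have H := is_derive1N (@is_derive1V _ id x 1 xn0 (is_derive_id x 1)).
  apply: (is_derive_eq H).
  by rewrite real_normK ?num_real// mulNr opprK mul1r.
rewrite (@ge0_continuous_FTC2y _ _ (fun z : R => - z^-1) s 0).
- by rewrite sub0e -EFinN opprK.
- by move=> x _; rewrite invr_ge0 exprn_ge0.
- apply: continuous_in_subspaceT => x; rewrite inE/= in_itv/= andbT => sx.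
  have x0 : 0 < x by apply: lt_le_trans sx.
  by apply: continuous_inv_sqr; rewrite gt_eqF.
- rewrite -oppr0; apply: cvgN; apply/gtr0_cvgV0; last exact: cvg_id.
  by apply: nbhs_pinfty_gt; rewrite num_real.
- by move=> x sx; have [] := dF x (lt_trans s0 sx).
- apply: cvg_at_right_filter; apply: cvgN; apply: cvgV => //; exact: lt0r_neq0.
- move=> x; rewrite in_itv/= andbT => sx.
  by rewrite derive1E; have [_ ->] := dF x (lt_trans s0 sx).
Qed.

Lemma integral_inv_sqr_rayN (R : realType) (s : R) : 0 < s ->
  (\int[@lebesgue_measure R]_(z in `]-oo, (- s)%R]) (`|z| ^- 2)%:E
   = (s^-1)%:E)%E.
Proof.
move=> s0; rewrite (@ge0_integration_by_substitutionNy _ (fun z : R => `|z| ^- 2)).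
- rewrite -(integral_inv_sqr_ray s0); apply: eq_integral => z _ /=.
  by rewrite normrN.
- apply: continuous_in_subspaceT => x; rewrite inE/= in_itv/= => sx.
  have x0 : x < 0 by apply: le_lt_trans sx _; rewrite oppr_lt0.
  by apply: continuous_inv_sqr; rewrite lt_eqF.
- by move=> x _; rewrite invr_ge0 exprn_ge0.
Qed.

(** * Truncated integrals and the half-Laplacian *)

Section Truncation.
Context {R : realType}.
Implicit Types (f g : R -> R) (x e : R).
Local Notation mu := (@lebesgue_measure R).

Definition far e : set R := [set z | e < `|z|].

Lemma far_split e : 0 <= e -> far e = `]e, +oo[ `|` `]-oo, (- e)%R[.
Proof.
move=> e0; apply/seteqP; split=> z; rewrite /far/= !in_itv/= andbT.
- by rewrite ltr_normr => /orP[->|]; [left|rewrite ltrNr; right].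
- by rewrite ltr_normr => -[->//|]; rewrite ltrNr => ->; rewrite orbT.
Qed.

Lemma measurable_far e : 0 <= e -> measurable (far e : set (measurableTypeR R)).
Proof. by move=> e0; rewrite far_split//; exact: measurableU. Qed.

Lemma measurable_inv_sqr e : 0 <= e ->
  measurable_fun (far e) (fun z : R => `|z| ^- 2).
Proof.
move=> e0; apply: open_continuous_measurable_fun.
  rewrite far_split//; apply: openU; [exact: rray_open|exact: lray_open].
move=> z; rewrite inE /far/= => ez; apply: continuous_inv_sqr.
by rewrite -normr_eq0 gt_eqF// (le_lt_trans e0).
Qed.

Lemma disjoint_rays e : 0 <= e ->
  [disjoint `]e, +oo[%classic & `]-oo, (- e)%R[%classic].
Proof.
move=> e0; apply/disj_setPS => z /=; rewrite !in_itv/= andbT => -[ez ze].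
have := lt_trans ez ze; rewrite ltNge => /negP; apply.
by rewrite (le_trans _ e0)// oppr_le0.
Qed.

(** The endpoints have measure zero, so both rays can be closed, which is the form that the
    fundamental theorem of calculus uses. *)
Lemma integral_far e (h : R -> \bar R) : 0 <= e -> measurable_fun (far e) h ->
  (\int[mu]_(z in far e) h z = \int[mu]_(z in `[e, +oo[) h z +
     \int[mu]_(z in `]-oo, (- e)%R]) h z)%E.
Proof.
move=> e0 mh; rewrite far_split// integral_setU//.
- have mfar := measurable_far e0.
  rewrite integral_itv_obnd_cbnd ?integral_itv_bndo_bndc//.
    by apply: measurable_funS mh => //; rewrite far_split//; exact: subsetUr.
  by apply: measurable_funS mh => //; rewrite far_split//; exact: subsetUl.
- by rewrite -far_split.
- exact: disjoint_rays.
Qed.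

Lemma integrable_inv_sqr e : 0 < e ->
  mu.-integrable (far e) (EFin \o (fun z : R => `|z| ^- 2)).
Proof.
move=> e0; have me := measurable_inv_sqr (ltW e0).
apply/integrableP; split; first exact/measurable_EFinP.
under eq_integral => z _ /=.
  rewrite ger0_norm; last by rewrite invr_ge0 exprn_ge0.
  over.
rewrite integral_far ?ltW//; last exact/measurable_EFinP.
by rewrite integral_inv_sqr_ray// integral_inv_sqr_rayN// -EFinD ltry.
Qed.

Definition quotient_at f x (z : R) : R := (f (x + z) - f x) / `|z| ^+ 2.

(** This is the class in which truncated integrals are finite, so that half-Laplacians may be
    subtracted. *)
Definition bounded_measurable f :=
  measurable_fun [set: R] f /\ exists M, forall y, `|f y| <= M.

Lemma measurable_quotient f x e : 0 <= e -> measurable_fun [set: R] f ->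
  measurable_fun (far e) (quotient_at f x).
Proof.
move=> e0 mf; apply: measurable_funM; last exact: measurable_inv_sqr.
apply: measurable_funB; last exact: measurable_cst.
apply: measurable_funTS; apply: (measurableT_comp mf).
exact: measurable_funD.
Qed.

(** If [f] is bounded by [M], the quotient is dominated by [2 * M / z ^+ 2], which is integrable
    away from 0. *)
Lemma integrable_quotient f x e : 0 < e -> bounded_measurable f ->
  mu.-integrable (far e) (EFin \o quotient_at f x).
Proof.
move=> e0 [mf [M fM]].
have H : mu.-integrable (far e) (fun z => ((2 * M)%:E * (`|z| ^- 2)%:E)%E).
  exact: (integrableZl (measurable_far (ltW e0)) _ (integrable_inv_sqr e0)).
apply: (le_integrable _ _ _ H); first exact: measurable_far (ltW e0).
  by apply/measurable_EFinP; apply: measurable_quotient => //; exact: ltW.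
move=> z _ /=; rewrite lee_fin /quotient_at normrM [leRHS]normrM.
rewrite ler_wpM2r//.
rewrite (le_trans (ler_normB _ _))// mulr2n mulrDl mul1r.
by rewrite (le_trans _ (ler_norm _))// lerD.
Qed.

Lemma bounded_measurableB f g : bounded_measurable f -> bounded_measurable g ->
  bounded_measurable (fun y => f y - g y).
Proof.
move=> [mf [M fM]] [mg [N gN]]; split; first exact: measurable_funB.
by exists (M + N) => y; rewrite (le_trans (ler_normB _ _))// lerD.
Qed.

Lemma bounded_measurable_cst (a : R) : bounded_measurable (fun=> a).
Proof. by split; [exact: measurable_cst|exists `|a|]. Qed.

(** For each positive [e] both truncated integrals are finite, so their extended-real difference is
    the integral of the difference. *)
Lemma half_laplacianB f g x l m : bounded_measurable f -> bounded_measurable g ->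
  half_laplacian_is f x l -> half_laplacian_is g x m ->
  half_laplacian_is (fun y => f y - g y) x (l - m).
Proof.
move=> bf bg hf hg; rewrite /half_laplacian_is EFinB.
have lm : (l%:E +? - m%:E)%E by rewrite -EFinN fin_num_adde_defl.
apply: cvg_trans (cvgeB lm hf hg); apply: near_eq_cvg; near=> e.
have e0 : 0 < e by near: e; exact: nbhs_right_gt.
have If := integrable_quotient x e0 bf; have Ig := integrable_quotient x e0 bg.
have me := measurable_far (ltW e0).
rewrite -muleBr//; last first.
  by rewrite fin_num_adde_defr//; apply: integrable_fin_num If.
congr (_ * _)%E; rewrite -(integralB_EFin me If Ig).
by apply: eq_integral => z _; rewrite -EFinB -mulrBl; congr (_ * _)%:E; ring.
Unshelve. all: by end_near. Qed.

Lemma half_laplacian_cst (a : R) x : half_laplacian_is (fun=> a) x 0.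
Proof.
rewrite /half_laplacian_is; apply: cvg_near_cst; apply: nearW => e.
by under eq_integral do rewrite subrr mul0r; rewrite integral0 mule0.
Qed.

(** Explicit computations enter here: a closed form [phi] of the truncated integrals for small [e]
    turns the extended-real limit into a real one. *)
Lemma half_laplacian_near f x (phi : R -> R) (l : R) :
  (\forall e \near 0^'+, \int[mu]_(z in far e) (quotient_at f x z)%:E
     = (phi e)%:E)%E ->
  phi e @[e --> 0^'+] --> pi * l -> half_laplacian_is f x l.
Proof.
move=> H phil; rewrite /half_laplacian_is.
have -> : l = pi^-1 * (pi * l).
  by rewrite mulrA mulVf ?mul1r// gt_eqF// pi_gt0.
apply: (@cvg_trans _ ((pi^-1 * phi e)%:E @[e --> 0^'+])).
  apply: near_eq_cvg; near=> e; rewrite EFinM; congr (_ * _)%E; apply/esym.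
  by near: e.
by apply: cvg_EFin; [exact: nearW|exact: cvgMr].
Unshelve. all: by end_near. Qed.

End Truncation.

(** * Unit jumps and the maximum principle *)

Section Indicators.
Context {R : realType}.
Implicit Types (f g w : R -> R) (x e c : R).
Local Notation mu := (@lebesgue_measure R).

Lemma bounded_measurable_ray c : bounded_measurable (fun y : R => (c <= y)%R%:R).
Proof.
split; last by exists 1 => y; case: (c <= y); rewrite ?normr1 ?normr0.
rewrite (_ : (fun y : R => _) = \1_(`[c, +oo[ : set R)) ?measurable_indic//.
by apply/funext => y; rewrite indicE mem_setE in_itv/= andbT.
Qed.

Lemma bounded_measurable_rayN c : bounded_measurable (fun y : R => (y <= c)%R%:R).
Proof.
split; last by exists 1 => y; case: (y <= c); rewrite ?normr1 ?normr0.
rewrite (_ : (fun y : R => _) = \1_(`]-oo, c] : set R)) ?measurable_indic//.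
by apply/funext => y; rewrite indicE mem_setE in_itv.
Qed.

(** The indicator vanishes at [x], and for [e < c - x] truncation removes nothing: the integral is
    that of the inverse square over [[c - x, +oo[], independent of [e]. *)
Lemma half_laplacian_ray c x : x < c ->
  half_laplacian_is (fun y : R => (c <= y)%R%:R) x (pi^-1 / (c - x)).
Proof.
move=> xc; have cx : 0 < c - x by rewrite subr_gt0.
apply: (@half_laplacian_near _ _ _ (fun=> (c - x)^-1)); last first.
  by rewrite mulrA divff ?mul1r ?gt_eqF ?pi_gt0//; exact: cvg_cst.
near=> e.
have ec : e < c - x by near: e; exact: nbhs_right_lt.
have e0 : 0 < e by near: e; exact: nbhs_right_gt.
rewrite -integral_inv_sqr_ray//.
rewrite (_ : `[c - x, +oo[%classic = far e `&` `[c - x, +oo[); last first.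
  rewrite setIidr// => z; rewrite /far/= in_itv/= andbT => cz.
  by rewrite (lt_le_trans ec)// (le_trans cz)// ler_norm.
rewrite integral_mkcondr; apply: eq_integral => z _.
rewrite patchE mem_setE in_itv/= andbT /quotient_at lerBlDl.
rewrite [X in _ - X](_ : _ = 0); last by rewrite leNgt xc.
by rewrite subr0; case: ifP => _; rewrite ?mul1r ?mul0r.
Unshelve. all: by end_near. Qed.

Lemma half_laplacian_rayN c x : c < x ->
  half_laplacian_is (fun y : R => (y <= c)%R%:R) x (pi^-1 / (x - c)).
Proof.
move=> xc; have cx : 0 < x - c by rewrite subr_gt0.
apply: (@half_laplacian_near _ _ _ (fun=> (x - c)^-1)); last first.
  by rewrite mulrA divff ?mul1r ?gt_eqF ?pi_gt0//; exact: cvg_cst.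
near=> e.
have ec : e < x - c by near: e; exact: nbhs_right_lt.
have e0 : 0 < e by near: e; exact: nbhs_right_gt.
rewrite -integral_inv_sqr_rayN//.
rewrite (_ : `]-oo, (- (x - c))%R]%classic =
    far e `&` `]-oo, (- (x - c))%R]); last first.
  rewrite setIidr// => z; rewrite /far/= in_itv/= => cz.
  by rewrite (lt_le_trans ec)// -normrN (le_trans _ (ler_norm _))// lerNr.
rewrite integral_mkcondr; apply: eq_integral => z _.
rewrite patchE mem_setE in_itv/= /quotient_at opprB lerBrDl.
rewrite [X in _ - X](_ : _ = 0); last by rewrite leNgt xc.
by rewrite subr0; case: ifP => _; rewrite ?mul1r ?mul0r.
Unshelve. all: by end_near. Qed.

(* At an interior positive maximum the truncated integrals stay below
   [- w x / (a - b)], the contribution of the ray to the right of [a]. *)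
Lemma maximum_principle w (b a : R) : bounded_measurable w -> b <= a ->
  {within `[b, a], continuous w} ->
  (forall y, ~~ (b < y < a) -> w y <= 0) ->
  (forall x, b < x < a -> half_laplacian_is w x 0) ->
  forall y, w y <= 0.
Proof.
move=> bw ba cw w_out hw y; rewrite leNgt; apply/negP => wy0.
have [x _ xmax] := EVT_max ba cw.
have yI : b < y < a.
  by apply: contraT => /w_out; rewrite leNgt wy0.
have wx0 : 0 < w x.
  apply: lt_le_trans wy0 (xmax _ _); rewrite in_itv/=.
  by case/andP: yI => /ltW -> /ltW ->.
have xI : b < x < a.
  by apply: contraT => /w_out; rewrite leNgt wx0.
have wmax z : w z <= w x.
  have [zI|/w_out wz] := boolP (b < z < a); last exact: le_trans wz (ltW wx0).
  by apply: xmax; rewrite in_itv/=; case/andP: zI => /ltW -> /ltW ->.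
have ab0 : 0 < a - b by move/andP: xI => [bx xa]; rewrite subr_gt0 (lt_trans bx).
(* If all truncations for small [e] are at most [- m < 0], they cannot tend to 0. *)
pose m := pi^-1 * (w x / (a - b)).
have m0 : 0 < m by rewrite !mulr_gt0// ?invr_gt0// pi_gt0.
suff : (0 <= (- m)%:E :> \bar R)%E by rewrite lee_fin lerNr oppr0 leNgt m0.
apply: (cvge_le _ (hw x xI)); near=> e.
have ec : e < a - b by near: e; exact: nbhs_right_lt.
have e0 : 0 < e by near: e; exact: nbhs_right_gt.
have mfar := measurable_far (ltW e0).
rewrite /m -mulrN EFinM lee_wpmul2l//; first by rewrite lee_fin invr_ge0 pi_ge0.
(* The opposite of the quotient is nonnegative because [x] is a global maximum; this allows dropping
   part of the domain. *)
pose p z := (w x - w (x + z)) * `|z| ^- 2.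
have p_ge0 z : 0 <= p z by rewrite mulr_ge0 ?invr_ge0 ?exprn_ge0 ?subr_ge0.
have mp : measurable_fun (far e) (EFin \o p).
  apply/measurable_EFinP; rewrite (_ : p = \- (quotient_at w x)); last first.
    by apply/funext => z; rewrite /p /quotient_at/= -mulNr opprB.
  by apply: measurableT_comp => //; apply: measurable_quotient (ltW e0) _; case: bw.
under eq_integral => z _.
  rewrite (_ : _%:E = - (p z)%:E)%E; last by rewrite -EFinN /p -mulNr opprB.
  over.
rewrite integral_ge0N; last by move=> z _; rewrite lee_fin.
rewrite EFinN leeN2 EFinM -integral_inv_sqr_ray//.
have sfar : `[a - b, +oo[ `<=` far e.
  move=> z; rewrite /far/= in_itv/= andbT => cz.
  by rewrite (lt_le_trans ec)// (le_trans cz)// ler_norm.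
have mray : measurable_fun (`[a - b, +oo[ : set (measurableTypeR R))
    (fun z : R => `|z| ^- 2).
  exact: measurable_funS (measurable_inv_sqr (ltW e0)).
rewrite -ge0_integralZl//; last 2 first.
- exact/measurable_EFinP.
- by rewrite lee_fin ltW.
(* On this ray [x + z >= a], because [x > b]; hence [w (x + z) <= 0] and [p z] is at least
   [w x / z ^+ 2]. *)
apply: (@le_trans _ _ (\int[mu]_(z in `[(a - b)%R, +oo[) (p z)%:E)%E); last first.
  by apply: ge0_subset_integral => // z _; rewrite lee_fin.
apply: ge0_le_integral => //.
- by move=> z _; rewrite lee_fin mulr_ge0 ?invr_ge0 ?exprn_ge0// ltW.
- by apply/measurable_EFinP; apply: measurable_funM => //.
- exact: measurable_funS mp.
- move=> z/=; rewrite in_itv/= andbT => abz.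
  rewrite lee_fin /p ler_wpM2r ?invr_ge0 ?exprn_ge0// lerBrDl gerDr.
  apply: w_out; rewrite negb_and -!leNgt; apply/orP; right.
  by move: xI abz => /andP[+ _]; lra.
Unshelve. all: by end_near. Qed.

End Indicators.

(** * One-sided difference quotients and an arctangent identity *)

Section OneSided.
Context {R : realType}.
Implicit Types (f : R -> R) (x d : R).

Lemma is_derive1_right f x d : is_derive x 1 f d ->
  (f (x + e) - f x) / e @[e --> 0^'+] --> d.
Proof.
move=> [df <-].
apply: (@cvg_trans _ ((h^-1 *: ((f \o shift x) (h *: 1) - f x)) @[h --> 0^'+])).
  apply: near_eq_cvg; apply: nearW => e /=.
  by rewrite [LHS]mulrC /GRing.scale/= mulr1 [e + x]addrC.
apply: cvg_trans df; apply: cvg_app; apply: within_subset => z /= z0.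
by rewrite gt_eqF.
Qed.

Lemma is_derive1_left f x d : is_derive x 1 f d ->
  (f (x - e) - f x) / e @[e --> 0^'+] --> - d.
Proof.
move=> df.
have dg : is_derive (0 : R) 1 (fun e : R => x - e) (- 1).
  have H := is_derive1D (is_derive1_cst 0 x) (is_derive1N (is_derive_id (0 : R) 1)).
  by apply: (is_derive_eq H); rewrite add0r.
have dfx : is_derive (x - 0) 1 f d by rewrite subr0.
have H := is_derive1_right (@is_derive1_chain _ f (fun e => x - e) 0 d (-1) dfx dg).
rewrite mulrN1 in H; apply: cvg_trans H; apply: near_eq_cvg; apply: nearW => e /=.
by rewrite subr0 add0r.
Qed.

(** This is the tangent subtraction formula at [pi / 4]; for [t > 0] the angle [pi / 4 - atan t]
    stays in the range where [atan] inverts [tan]. *)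
Lemma atan_moebius (t : R) : 0 < t -> atan ((1 - t) / (1 + t)) = pi / 4 - atan t.
Proof.
move=> t0.
have pi0 : 0 < pi :> R by exact: pi_gt0.
have at0 : 0 < atan t by rewrite -(@atan0 R) lt_atan.
have atp : atan t < pi / 2 := atan_ltpi2 t.
have c4 : cos (pi / 4) != 0 :> R.
  by rewrite gt_eqF// cos_gt0_pihalf//; apply/andP; split; lra.
have ct : cos (- atan t) != 0.
  by rewrite gt_eqF// cos_gt0_pihalf//; apply/andP; split; lra.
rewrite -[RHS]tanK; last by rewrite in_itv/=; apply/andP; split; lra.
by rewrite tanD// tan_piquarter tanN atanK mul1r opprK.
Qed.

End OneSided.

(** * The arctangent profile and its half-Laplacian *)

Section Profile.
Context {R : realType}.
Implicit Types (a b c k x y : R).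

(** With [q = k * sqrt (y - b) / sqrt (a - y)] this is [(q - 1) / (q + 1)], cleared of the division
    by [sqrt (a - y)]. Since [Num.sqrt] is 0 on negative numbers, the expression makes sense on the
    whole line and is [-1] left of [b] and [1] right of [a]. *)
Definition moebius b a k y : R :=
  (k * Num.sqrt (y - b) - Num.sqrt (a - y)) /
  (k * Num.sqrt (y - b) + Num.sqrt (a - y)).

(** On [(b, a)] this is [2 / pi * atan q] with [q] as above; the form through [moebius] is
    continuous at [a] too, where [q] blows up. *)
Definition profile b a k y : R := 2^-1 + 2 / pi * atan (moebius b a k y).

Lemma moebius_den_gt0 b a k y : b < a -> 0 < k ->
  0 < k * Num.sqrt (y - b) + Num.sqrt (a - y).
Proof.
move=> ba k0; have s1 := sqrtr_ge0 (y - b); have s2 := sqrtr_ge0 (a - y).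
have [yb|yb] := leP y b.
  by rewrite ltr_wpDl ?mulr_ge0 ?(ltW k0)// sqrtr_gt0 subr_gt0 (le_lt_trans yb).
by rewrite ltr_pwDl// mulr_gt0// sqrtr_gt0 subr_gt0.
Qed.

Lemma continuous_sqrt_subr b y : {for y, continuous (fun y : R => Num.sqrt (y - b))}.
Proof.
apply: (@continuous_comp _ _ _ (fun y : R => y - b) Num.sqrt).
  by apply: continuousB; [exact: id|exact: cvg_cst].
exact: sqrt_continuous.
Qed.

Lemma continuous_sqrt_subl a y : {for y, continuous (fun y : R => Num.sqrt (a - y))}.
Proof.
apply: (@continuous_comp _ _ _ (fun y : R => a - y) Num.sqrt).
  by apply: continuousB; [exact: cvg_cst|exact: id].
exact: sqrt_continuous.
Qed.

Lemma continuous_moebius b a k : b < a -> 0 < k -> continuous (moebius b a k).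
Proof.
move=> ba k0 y; rewrite /moebius.
have c1 : k * Num.sqrt (y - b) @[y --> y] --> k * Num.sqrt (y - b).
  by apply: cvgM; [exact: cvg_cst|exact: continuous_sqrt_subr].
apply: cvgM; first by apply: cvgB => //; exact: continuous_sqrt_subl.
apply: cvgV; first by rewrite gt_eqF// moebius_den_gt0.
by apply: cvgD => //; exact: continuous_sqrt_subl.
Qed.

Lemma continuous_profile b a k : b < a -> 0 < k -> continuous (profile b a k).
Proof.
move=> ba k0 y; apply: cvgD; first exact: cvg_cst.
apply: cvgM; first exact: cvg_cst.
apply: continuous_cvg; first exact: continuous_atan.
exact: continuous_moebius.
Qed.

Lemma profile_left b a k y : b < a -> y <= b -> profile b a k y = 0.
Proof.
move=> ba yb; rewrite /profile /moebius (ler0_sqrtr (_ : y - b <= 0)) ?subr_le0//.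
rewrite mulr0 sub0r add0r mulNr divff; last first.
  by rewrite gt_eqF// sqrtr_gt0 subr_gt0 (le_lt_trans yb).
rewrite atanN atan1.
by move: (@pi R) (lt0r_neq0 (pi_gt0 R)) => p p0; field.
Qed.

Lemma profile_right b a k y : b < a -> 0 < k -> a <= y -> profile b a k y = 1.
Proof.
move=> ba k0 ay; rewrite /profile /moebius (ler0_sqrtr (_ : a - y <= 0)) ?subr_le0//.
rewrite subr0 addr0 divff; last first.
  by rewrite mulf_neq0 ?gt_eqF// sqrtr_gt0 subr_gt0 (lt_le_trans ba).
rewrite atan1.
by move: (@pi R) (lt0r_neq0 (pi_gt0 R)) => p p0; field.
Qed.

Lemma profile_itv b a k y : b < a -> 0 < k -> 0 <= profile b a k y <= 1.
Proof.
move=> ba k0; have d0 := moebius_den_gt0 y ba k0.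
have s1 : 0 <= k * Num.sqrt (y - b) by rewrite mulr_ge0// ltW.
have s2 := sqrtr_ge0 (a - y).
rewrite /profile /moebius; set v := (X in atan X).
have v1 : v <= 1 by rewrite ler_pdivrMr// mul1r; lra.
have v2 : -1 <= v by rewrite ler_pdivlMr// mulN1r; lra.
have p0 : 0 < pi :> R := pi_gt0 R.
have := le_atan v1; have := le_atan v2; rewrite atanN atan1 => a1 a2.
have [h1 h2] : - 2^-1 <= 2 / pi * atan v /\ 2 / pi * atan v <= 2^-1.
  rewrite mulrAC ler_pdivrMr// ler_pdivlMr//; split; lra.
by apply/andP; split; lra.
Qed.

(** In this complementary form the argument of [atan] is small near [a] and for large [k], which
    serves the normal derivative and the limit of the barrier. *)
Lemma profileCE b a k y : 0 < k -> b < y < a ->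
  1 - profile b a k y =
    2 / pi * atan (Num.sqrt (a - y) / (k * Num.sqrt (y - b))).
Proof.
move=> k0 /andP[yb ya].
have s1 : 0 < Num.sqrt (y - b) by rewrite sqrtr_gt0 subr_gt0.
have s2 : 0 < Num.sqrt (a - y) by rewrite sqrtr_gt0 subr_gt0.
have s3 : 0 < k * Num.sqrt (y - b) by rewrite mulr_gt0.
rewrite /profile /moebius.
have -> : (k * Num.sqrt (y - b) - Num.sqrt (a - y)) /
          (k * Num.sqrt (y - b) + Num.sqrt (a - y)) =
  (1 - Num.sqrt (a - y) / (k * Num.sqrt (y - b))) /
  (1 + Num.sqrt (a - y) / (k * Num.sqrt (y - b))).
  field; rewrite !gt_eqF//=; exact: addr_gt0.
rewrite atan_moebius ?divr_gt0//.
by move: (atan _) (@pi R) (lt0r_neq0 (pi_gt0 R)) => t p p0; field.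
Qed.

Lemma profileE b a k y : 0 < k -> b < y < a ->
  profile b a k y = 2 / pi * atan (k * Num.sqrt (y - b) / Num.sqrt (a - y)).
Proof.
move=> k0 /andP[yb ya].
have s1 : 0 < Num.sqrt (y - b) by rewrite sqrtr_gt0 subr_gt0.
have s2 : 0 < Num.sqrt (a - y) by rewrite sqrtr_gt0 subr_gt0.
have s3 : 0 < k * Num.sqrt (y - b) by rewrite mulr_gt0.
rewrite /profile /moebius.
have -> : (k * Num.sqrt (y - b) - Num.sqrt (a - y)) /
          (k * Num.sqrt (y - b) + Num.sqrt (a - y)) =
  - ((1 - k * Num.sqrt (y - b) / Num.sqrt (a - y)) /
  (1 + k * Num.sqrt (y - b) / Num.sqrt (a - y))).
  by field; rewrite !gt_eqF ?addr_gt0// addrC addr_gt0.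
rewrite atanN atan_moebius ?divr_gt0//.
by move: (atan _) (@pi R) (lt0r_neq0 (pi_gt0 R)) => t p p0; field.
Qed.

Lemma is_derive_sqrt_subr b y : b < y ->
  is_derive y 1 (fun y : R => Num.sqrt (y - b)) (2 * Num.sqrt (y - b))^-1.
Proof.
move=> yb; have d1 : is_derive y 1 (fun y : R => y - b) 1.
  have H := is_derive1D (is_derive_id y 1) (is_derive1_cst y (- b)).
  by apply: (is_derive_eq H); rewrite addr0.
have yb0 : 0 < y - b by rewrite subr_gt0.
have H := @is_derive1_chain _ _ (fun y : R => y - b) _ _ _ (is_derive1_sqrt yb0) d1.
by apply: (is_derive_eq H); rewrite mulr1.
Qed.

Lemma is_derive_sqrt_subl a y : y < a ->
  is_derive y 1 (fun y : R => Num.sqrt (a - y)) (- (2 * Num.sqrt (a - y))^-1).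
Proof.
move=> ya; have d1 : is_derive y 1 (fun y : R => a - y) (-1).
  have H := is_derive1D (is_derive1_cst y a) (is_derive1N (is_derive_id y 1)).
  by apply: (is_derive_eq H); rewrite add0r.
have ya0 : 0 < a - y by rewrite subr_gt0.
have H := @is_derive1_chain _ _ (fun y : R => a - y) _ _ _ (is_derive1_sqrt ya0) d1.
by apply: (is_derive_eq H); rewrite mulrN1.
Qed.

Lemma is_derive_moebius b a k y : 0 < k -> b < y < a ->
  is_derive y 1 (moebius b a k)
    (k * (a - b) / (Num.sqrt (y - b) * Num.sqrt (a - y) *
       (k * Num.sqrt (y - b) + Num.sqrt (a - y)) ^+ 2)).
Proof.
move=> k0 /andP[yb ya].
have d1 := is_derive_sqrt_subr yb.
have d2 := is_derive_sqrt_subl ya.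
have s1 : 0 < Num.sqrt (y - b) by rewrite sqrtr_gt0 subr_gt0.
have s2 : 0 < Num.sqrt (a - y) by rewrite sqrtr_gt0 subr_gt0.
have dk := is_derive1M (is_derive1_cst y k) d1.
pose N y := k * Num.sqrt (y - b) - Num.sqrt (a - y).
pose M y := k * Num.sqrt (y - b) + Num.sqrt (a - y).
have dN : is_derive y 1 N _ := is_derive1D dk (is_derive1N d2).
have dM : is_derive y 1 M _ := is_derive1D dk d2.
have M0 : M y != 0 by rewrite gt_eqF// moebius_den_gt0// (lt_trans yb).
have dv := is_derive1M dN (@is_derive1V _ M y _ M0 dM).
apply: (is_derive_eq dv).
have e1 : Num.sqrt (y - b) ^+ 2 = y - b by rewrite sqr_sqrtr// subr_ge0 ltW.
have e2 : Num.sqrt (a - y) ^+ 2 = a - y by rewrite sqr_sqrtr// subr_ge0 ltW.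
rewrite /N /M; move: M0 s1 s2 e1 e2; rewrite /M.
move: (Num.sqrt (y - b)) (Num.sqrt (a - y)) => {dv dM dN N M dk d1 d2} s1 s2.
move=> M0 s10 s20 e1 e2.
have -> : a - b = s1 ^+ 2 + s2 ^+ 2 by rewrite e1 e2; ring.
by field; rewrite M0 !lt0r_neq0.
Qed.

(** The derivative of [atan] produces the denominator [(a - y) + k ^+ 2 * (y - b)], affine in [y];
    the relation between [k] and [c] says that its root is [c]. The pole may lie on either side of
    [[b, a]]. *)
Lemma is_derive_profile b a k c y : 0 < k -> b < y < a -> b != c ->
  k ^+ 2 * (c - b) = c - a ->
  is_derive y 1 (profile b a k)
    (k * (c - b) / (pi * (c - y) * (Num.sqrt (y - b) * Num.sqrt (a - y)))).
Proof.
move=> k0 yI bc kc; have /andP[yb ya] := yI.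
have dG := is_derive1D (is_derive1_cst y 2^-1) (is_derive1M (is_derive1_cst y (2 / pi))
  (is_derive1_chain (is_derive1_atan _) (is_derive_moebius k0 yI))).
apply: (is_derive_eq dG); rewrite /moebius {dG}.
have M0 := lt0r_neq0 (moebius_den_gt0 y (lt_trans yb ya) k0).
have s1 : 0 < Num.sqrt (y - b) by rewrite sqrtr_gt0 subr_gt0.
have s2 : 0 < Num.sqrt (a - y) by rewrite sqrtr_gt0 subr_gt0.
have e1 : Num.sqrt (y - b) ^+ 2 = y - b by rewrite sqr_sqrtr// subr_ge0 ltW.
have e2 : Num.sqrt (a - y) ^+ 2 = a - y by rewrite sqr_sqrtr// subr_ge0 ltW.
move: (Num.sqrt (y - b)) (Num.sqrt (a - y)) M0 s1 s2 e1 e2 => s1 s2.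
move=> M0 s10 s20 e1 e2.
move: (atan _) (@pi R) (lt0r_neq0 (pi_gt0 R)) => A p p0.
have q0 : s2 ^+ 2 + k ^+ 2 * s1 ^+ 2 != 0.
  by rewrite gt_eqF// addr_gt0// ?mulr_gt0// exprn_gt0.
have abE : a - b = s1 ^+ 2 + s2 ^+ 2 by rewrite e1 e2; ring.
have s12 : s1 ^+ 2 + s2 ^+ 2 != 0 by rewrite gt_eqF// addr_gt0// exprn_gt0.
have cb : c - b != 0 by rewrite subr_eq0 eq_sym.
(* Writing [c - y] and [a - b] through the roots [s1] and [s2] makes the goal a rational identity
   for [field]. *)
have cyE : c - y = (s2 ^+ 2 + k ^+ 2 * s1 ^+ 2) * (c - b) / (s1 ^+ 2 + s2 ^+ 2).
  apply: (mulIf s12); rewrite divfK//.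
  have -> : (s2 ^+ 2 + k ^+ 2 * s1 ^+ 2) * (c - b) =
    s2 ^+ 2 * (c - b) + s1 ^+ 2 * (k ^+ 2 * (c - b)) by ring.
  by rewrite kc e1 e2; ring.
rewrite cyE abE; field.
have s10' := lt0r_neq0 s10; have s20' := lt0r_neq0 s20.
rewrite s12 s20' s10' cb exprMn q0 p0 M0 lt0r_neq0//.
by rewrite ltr_pwDl ?sqr_ge0// lt_neqAle eq_sym expf_neq0//= sqr_ge0.
Qed.

End Profile.

(** * The truncated integrals of the profile in closed form, and their limit *)

Section ProfileLaplacian.
Context {R : realType}.
Implicit Types (a b c k x y z e : R).
Local Notation mu := (@lebesgue_measure R).

Lemma bounded_measurable_profile b a k : b < a -> 0 < k ->
  bounded_measurable (profile b a k).
Proof.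
move=> ba k0; split.
  by apply: continuous_measurable_fun; exact: continuous_profile.
exists 1 => y; have /andP[p0 p1] := profile_itv y ba k0.
by rewrite ger0_norm.
Qed.

(** The gain is chosen so that the only zero is [y = x]. On [(b, a)] the logarithmic derivative is
    [sqrt (x - b) * sqrt (a - x) / ((y - x) * sqrt (y - b) * sqrt (a - y))], which supplies the
    logarithm of the primitive. *)
Definition pole_ratio b a x : R -> R :=
  moebius b a (Num.sqrt (a - x) / Num.sqrt (x - b)).

Lemma pole_ratio_neq0 b a x y : b < x < a -> y != x -> pole_ratio b a x y != 0.
Proof.
move=> /andP[bx xa] yx; rewrite /pole_ratio.
have t10 : 0 < Num.sqrt (x - b) by rewrite sqrtr_gt0 subr_gt0.
have t20 : 0 < Num.sqrt (a - x) by rewrite sqrtr_gt0 subr_gt0.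
have k0 := divr_gt0 t20 t10.
rewrite mulf_neq0 ?invr_eq0 ?(lt0r_neq0 (moebius_den_gt0 _ (lt_trans bx xa) k0))//.
rewrite subr_eq0; apply/eqP => /(congr1 ( *%R^~ (Num.sqrt (x - b)))).
rewrite mulrAC divfK ?gt_eqF//; apply/eqP.
(* One root grows with [y] and the other decreases. Only one comparison is strict in each case,
   because the other root may already be constantly 0 outside [(b, a)]. *)
have [xy|xy|/eqP] := ltgtP x y; last by rewrite eq_sym (negPf yx).
- rewrite gt_eqF// (@le_lt_trans _ _ (Num.sqrt (a - x) * Num.sqrt (x - b)))//.
    by rewrite ler_wpM2r ?(ltW t10)// ler_wsqrtr// lerD2l lerN2 ltW.
  by rewrite ltr_pM2l// ltr_sqrt ?subr_gt0 ?(lt_trans bx)// ltrD2r.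
- rewrite lt_eqF// (@le_lt_trans _ _ (Num.sqrt (a - x) * Num.sqrt (x - b)))//.
    by rewrite ler_wpM2l ?(ltW t20)// ler_wsqrtr// lerD2r ltW.
  by rewrite ltr_pM2r// ltr_sqrt ?subr_gt0 ?(lt_trans _ xa)// ltrD2l ltrN2.
Qed.

Lemma continuous_pole_ratio b a x : b < x < a -> continuous (pole_ratio b a x).
Proof.
move=> /andP[bx xa]; apply: continuous_moebius (lt_trans bx xa) _.
by rewrite divr_gt0// sqrtr_gt0 subr_gt0.
Qed.

(* Integrating by parts turns the quotient into [profile' y / (y - x)], and
   [profile' y = const / ((c - y) sqrt (y - b) sqrt (a - y))]; partial fractions
   in [y] leave [profile'] itself and a logarithm. *)
Definition quotient_primitive b a k c x z : R :=
  (c - x)^-1 * (profile b a k (x + z) +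
    k * (c - b) / (2 * pi * Num.sqrt (x - b) * Num.sqrt (a - x)) *
      ln (pole_ratio b a x (x + z) * pole_ratio b a x (x + z))) -
  (profile b a k (x + z) - profile b a k x) * z^-1.

(** Squaring [pole_ratio] inside the logarithm treats both signs of [z] at once. The rest is algebra
    in the four square roots. *)
Lemma is_derive_quotient_primitive b a k c x z : 0 < k -> b < x < a ->
  b != c -> x != c -> k ^+ 2 * (c - b) = c - a -> z != 0 -> b < x + z < a ->
  is_derive z 1 (quotient_primitive b a k c x) (quotient_at (profile b a k) x z).
Proof.
move=> k0 xI bc xc kc z0 yI; have /andP[bx xa] := xI; have /andP[yb ya] := yI.
have t10 : 0 < Num.sqrt (x - b) by rewrite sqrtr_gt0 subr_gt0.
have t20 : 0 < Num.sqrt (a - x) by rewrite sqrtr_gt0 subr_gt0.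
have ba := lt_trans bx xa.
have K0 := divr_gt0 t20 t10.
have Q0 : pole_ratio b a x (x + z) != 0.
  by apply: pole_ratio_neq0 => //; rewrite -subr_eq0 addrC addKr.
have QQ0 : 0 < pole_ratio b a x (x + z) * pole_ratio b a x (x + z).
  by rewrite -expr2 lt_neqAle eq_sym expf_neq0//= sqr_ge0.
have dS := is_derive1_shift z x.
have dG : is_derive z 1 (fun z => profile b a k (x + z)) _ :=
  @is_derive1_chain _ (profile b a k) (fun z => x + z) _ _ _
    (is_derive_profile k0 yI bc kc) dS.
have dQ : is_derive z 1 (fun z => pole_ratio b a x (x + z)) _ :=
  @is_derive1_chain _ (pole_ratio b a x) (fun z => x + z) _ _ _
    (is_derive_moebius K0 yI) dS.
have dL : is_derive z 1
    (fun z => ln (pole_ratio b a x (x + z) * pole_ratio b a x (x + z))) _ :=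
  @is_derive1_chain _ (@ln R)
    (fun z => pole_ratio b a x (x + z) * pole_ratio b a x (x + z)) _ _ _
    (is_derive1_ln QQ0) (is_derive1M dQ dQ).
have dF := is_derive1D
  (is_derive1M (is_derive1_cst z (c - x)^-1)
     (is_derive1D dG (is_derive1M (is_derive1_cst z
       (k * (c - b) / (2 * pi * Num.sqrt (x - b) * Num.sqrt (a - x)))) dL)))
  (is_derive1N (is_derive1M (is_derive1D dG (is_derive1_cst z (- profile b a k x)))
     (@is_derive1V _ id z _ z0 (is_derive_id z 1)))).
apply: (is_derive_eq dF); rewrite /quotient_at real_normK ?num_real//.
have Mne0 := lt0r_neq0 (moebius_den_gt0 (x + z) ba K0).
have s1 : 0 < Num.sqrt (x + z - b) by rewrite sqrtr_gt0 subr_gt0.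
have s2 : 0 < Num.sqrt (a - (x + z)) by rewrite sqrtr_gt0 subr_gt0.
have e1 : Num.sqrt (x + z - b) ^+ 2 = x + z - b by rewrite sqr_sqrtr// subr_ge0 ltW.
have e2 : Num.sqrt (a - (x + z)) ^+ 2 = a - (x + z) by rewrite sqr_sqrtr// subr_ge0 ltW.
have f1 : Num.sqrt (x - b) ^+ 2 = x - b by rewrite sqr_sqrtr// subr_ge0 ltW.
have f2 : Num.sqrt (a - x) ^+ 2 = a - x by rewrite sqr_sqrtr// subr_ge0 ltW.
move: Q0; clear dF dL dQ dG QQ0; rewrite /pole_ratio /moebius.
move: (profile b a k (x + z)) (profile b a k x) (ln _) => G G0 L.
move: Mne0 s1 s2 e1 e2 t10 t20 f1 f2 {K0}.
move: (Num.sqrt (x + z - b)) (Num.sqrt (a - (x + z))) => s1 s2.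
move: (Num.sqrt (x - b)) (Num.sqrt (a - x)) => t1 t2.
move=> Mne0 s10 s20 e1 e2 t10 t20 f1 f2 Q0.
move: (@pi R) (lt0r_neq0 (pi_gt0 R)) => p p0.
(* This links the increment [z] to the numerator and denominator of [pole_ratio]; eliminating
   [a - b] with it is what lets [field] conclude. *)
have abz : (a - b) * z = (t2 / t1 * s1 - s2) * (t2 / t1 * s1 + s2) * t1 ^+ 2.
  transitivity (t2 ^+ 2 * s1 ^+ 2 - s2 ^+ 2 * t1 ^+ 2).
    by rewrite e1 e2 f1 f2; ring.
  by field; rewrite lt0r_neq0.
have N0 : t2 / t1 * s1 - s2 != 0 by move: Q0; rewrite mulf_eq0 negb_or => /andP[].
have abE : a - b = (t2 / t1 * s1 - s2) * (t2 / t1 * s1 + s2) * t1 ^+ 2 / z.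
  by rewrite -abz mulfK.
(* [(c - y) * (a - b)] is [c - b] times a sum of positive terms, so the pole is not met inside the
   interval. *)
have cy0 : c - (x + z) != 0.
  have : (c - (x + z)) * (a - b) != 0.
    rewrite (_ : _ * _ = (s2 ^+ 2 + k ^+ 2 * s1 ^+ 2) * (c - b)).
      rewrite mulf_neq0 ?subr_eq0 1?[c == b]eq_sym//.
      by rewrite lt0r_neq0// addr_gt0// ?mulr_gt0// exprn_gt0.
    transitivity (s2 ^+ 2 * (c - b) + s1 ^+ 2 * (k ^+ 2 * (c - b))); last by ring.
    by rewrite kc e1 e2; ring.
  by rewrite mulf_eq0 negb_or => /andP[].
have cx0 : c - x != 0 by rewrite subr_eq0 eq_sym.
have s10' := lt0r_neq0 s10; have s20' := lt0r_neq0 s20.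
have t10' := lt0r_neq0 t10; have t20' := lt0r_neq0 t20.
set N := _ - s2 in N0 abE abz Q0 *; set M := _ + s2 in Mne0 abE abz Q0 *.
rewrite abE; clearbody N M; field.
by rewrite z0 s20' s10' cy0 p0 Mne0 t10' N0 t20' cx0.
Qed.

Lemma continuous_quotient_primitive b a k c x z : 0 < k -> b < x < a ->
  z != 0 -> {for z, continuous (quotient_primitive b a k c x)}.
Proof.
move=> k0 xI z0; have /andP[bx xa] := xI; have ba := lt_trans bx xa.
have Q0 : pole_ratio b a x (x + z) != 0.
  by apply: pole_ratio_neq0 => //; rewrite -subr_eq0 addrC addKr.
have cS : x + z @[z --> z] --> x + z by apply: cvgD; [exact: cvg_cst|exact: cvg_id].
have cG : profile b a k (x + z) @[z --> z] --> profile b a k (x + z).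
  by apply: continuous_cvg cS; exact: continuous_profile.
have cQ : pole_ratio b a x (x + z) @[z --> z] --> pole_ratio b a x (x + z).
  by apply: continuous_cvg cS; exact: continuous_pole_ratio.
apply: cvgB; last first.
  apply: cvgM; first by apply: cvgB => //; exact: cvg_cst.
  by apply: cvgV.
apply: cvgM; first exact: cvg_cst.
apply: cvgD => //; apply: cvgM; first exact: cvg_cst.
apply: continuous_cvg; last exact: cvgM.
by apply: continuous_ln; rewrite -expr2 lt_neqAle eq_sym expf_neq0//= sqr_ge0.
Qed.

(** At the endpoint [pole_ratio] is 1, so the logarithm vanishes. The last term will cancel the
    integral over the tail beyond [a]. *)
Lemma quotient_primitive_right b a k c x : 0 < k -> b < x < a ->
  quotient_primitive b a k c x (a - x) =
    (c - x)^-1 - (1 - profile b a k x) / (a - x).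
Proof.
move=> k0 /andP[bx xa]; have ba := lt_trans bx xa.
rewrite /quotient_primitive (_ : x + (a - x) = a); last by ring.
rewrite profile_right// (_ : pole_ratio b a x a = 1).
  by rewrite mulr1 ln1 mulr0 addr0 mulr1.
rewrite /pole_ratio /moebius subrr sqrtr0 subr0 addr0 divff//.
by rewrite !mulf_neq0 ?invr_eq0// gt_eqF// sqrtr_gt0 subr_gt0.
Qed.

(** Here [pole_ratio] is [-1], whose square again kills the logarithm; what is left cancels the tail
    beyond [b]. *)
Lemma quotient_primitive_left b a k c x : b < x < a ->
  quotient_primitive b a k c x (b - x) = profile b a k x / (b - x).
Proof.
move=> /andP[bx xa]; have ba := lt_trans bx xa.
rewrite /quotient_primitive (_ : x + (b - x) = b); last by ring.
rewrite profile_left// (_ : pole_ratio b a x b = -1).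
  by rewrite mulrNN mulr1 ln1 mulr0 addr0 mulr0 !sub0r mulNr opprK.
rewrite /pole_ratio /moebius subrr sqrtr0 mulr0 sub0r add0r mulNr divff//.
by rewrite gt_eqF// sqrtr_gt0 subr_gt0.
Qed.

Lemma integral_ray_split e A (h : R -> R) : 0 <= e -> e < A ->
  measurable_fun (far e) h ->
  (\int[mu]_(z in `[e, +oo[) (h z)%:E =
   \int[mu]_(z in `[e, A]) (h z)%:E + \int[mu]_(z in `[A, +oo[) (h z)%:E)%E.
Proof.
move=> e0 eA mh.
have mh1 : measurable_fun (`]e, +oo[ : set (measurableTypeR R)) (EFin \o h).
  apply/measurable_EFinP; apply: measurable_funS mh => //.
    exact: measurable_far.
  by rewrite far_split//; exact: subsetUl.
have sA : `]A, +oo[ `<=` `]e, +oo[.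
  by move=> z; rewrite /= !in_itv/= !andbT; exact: lt_trans.
have se : `]e, A] `<=` `]e, +oo[ by move=> z; rewrite /= !in_itv/= => /andP[->].
rewrite -integral_itv_obnd_cbnd//.
rewrite -(@integral_itv_obnd_cbnd _ e (BRight A)); last exact: measurable_funS mh1.
rewrite -(@integral_itv_obnd_cbnd _ A +oo%O); last exact: measurable_funS mh1.
rewrite -integral_setU//.
- by congr (integral _ _ _); rewrite -itv_bndbnd_setU// bnd_simp ltW.
- by apply: measurable_funS mh1 => //; rewrite subUset.
- apply/disj_setPS => z /=; rewrite !in_itv/= andbT => -[/andP[_ zA]].
  by rewrite ltNge zA.
Qed.

Lemma integral_rayN_split e A (h : R -> R) : 0 <= e -> e < A ->
  measurable_fun (far e) h ->
  (\int[mu]_(z in `]-oo, (- e)%R]) (h z)%:E =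
   \int[mu]_(z in `]-oo, (- A)%R]) (h z)%:E +
   \int[mu]_(z in `[(- A)%R, (- e)%R]) (h z)%:E)%E.
Proof.
move=> e0 eA mh; have eAN : - A < - e by rewrite ltrN2.
have mh1 : measurable_fun (`]-oo, (- e)%R[ : set (measurableTypeR R)) (EFin \o h).
  apply/measurable_EFinP; apply: measurable_funS mh => //.
    exact: measurable_far.
  by rewrite far_split//; exact: subsetUr.
have sA : `]-oo, (- A)%R[ `<=` `]-oo, (- e)%R[.
  by move=> z; rewrite /= !in_itv/= => /lt_trans; apply.
have se : `[(- A)%R, (- e)%R[ `<=` `]-oo, (- e)%R[.
  by move=> z; rewrite /= !in_itv/= => /andP[_ ->].
rewrite -integral_itv_bndo_bndc//.
rewrite -(@integral_itv_bndo_bndc _ (BLeft (- A)) (- e)); last first.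
  exact: measurable_funS mh1.
rewrite -(@integral_itv_bndo_bndc _ -oo%O (- A)); last exact: measurable_funS mh1.
rewrite -integral_setU//.
- by congr (integral _ _ _); rewrite -itv_bndbnd_setU// bnd_simp ltW.
- by apply: measurable_funS mh1 => //; rewrite subUset.
- apply/disj_setPS => z /=; rewrite !in_itv/= => -[zA /andP[Az _]].
  by move: zA; rewrite ltNge Az.
Qed.

Lemma continuous_quotient (f : R -> R) x z : continuous f -> z != 0 ->
  {for z, continuous (quotient_at f x)}.
Proof.
move=> cf z0; apply: cvgM; last exact: continuous_inv_sqr.
apply: cvgB; last exact: cvg_cst.
by apply: continuous_cvg; [exact: cf|apply: cvgD; [exact: cvg_cst|exact: cvg_id]].
Qed.

(** The condition [0 < l * u] keeps 0 out of [[l, u]] and covers both sides of the singularity. *)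
Lemma integral_quotient_profile_itv b a k c x l u : 0 < k -> b < x < a ->
  b != c -> x != c -> k ^+ 2 * (c - b) = c - a ->
  l < u -> 0 < l * u -> b <= x + l -> x + u <= a ->
  (\int[mu]_(z in `[l, u]) (quotient_at (profile b a k) x z)%:E =
   (quotient_primitive b a k c x u - quotient_primitive b a k c x l)%:E)%E.
Proof.
move=> k0 xI bc xc kc lu lu0 bl ua; have /andP[bx xa] := xI.
have ba := lt_trans bx xa.
have zn0 z : l <= z <= u -> z != 0.
  move=> /andP[lz zu]; apply/eqP => z0; move: lz zu lu0; rewrite z0 => l0 u0.
  by rewrite ltNge mulr_le0_ge0.
have dF z (lz : l < z) (zu : z < u) : is_derive z 1
    (quotient_primitive b a k c x) (quotient_at (profile b a k) x z).
  apply: is_derive_quotient_primitive => //; first by apply: zn0; rewrite !ltW.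
  by apply/andP; split; lra.
rewrite EFinB; apply: continuous_FTC2 => //.
- apply: continuous_in_subspaceT => z; rewrite inE/= in_itv/= => zI.
  by apply: continuous_quotient (zn0 _ zI); exact: continuous_profile.
- split.
  + move=> z; rewrite in_itv/= => /andP[lz zu].
    by have [] := dF z lz zu.
  + apply: cvg_at_right_filter; apply: continuous_quotient_primitive => //.
    by apply: zn0; rewrite lexx ltW.
  + apply: cvg_at_left_filter; apply: continuous_quotient_primitive => //.
    by apply: zn0; rewrite lexx ltW.
- move=> z; rewrite in_itv/= => /andP[lz zu]; rewrite derive1E.
  by have [_ ->] := dF z lz zu.
Qed.

(** The profile is constant beyond [a] and beyond [b], so the tails are explicit; they cancel the
    boundary values of the primitive at [a - x] and [b - x] up to [(c - x)^-1]. *)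
Lemma integral_quotient_profile b a k c x e : 0 < k -> b < x < a ->
  b != c -> x != c -> k ^+ 2 * (c - b) = c - a ->
  0 < e -> e < a - x -> e < x - b ->
  (\int[mu]_(z in far e) (quotient_at (profile b a k) x z)%:E =
   ((c - x)^-1 + (quotient_primitive b a k c x (- e) -
                  quotient_primitive b a k c x e))%:E)%E.
Proof.
move=> k0 xI bc xc kc e0 ea eb; have /andP[bx xa] := xI.
have ba := lt_trans bx xa.
have ax0 : 0 < a - x by rewrite subr_gt0.
have xb0 : 0 < x - b by rewrite subr_gt0.
have bm := bounded_measurable_profile ba k0.
have mq : measurable_fun (far e) (quotient_at (profile b a k) x).
  by apply: measurable_quotient => //; [exact: ltW|case: bm].
rewrite integral_far ?ltW//; last exact/measurable_EFinP.
rewrite (integral_ray_split (ltW e0) ea mq) (integral_rayN_split (ltW e0) eb mq).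
rewrite (integral_quotient_profile_itv k0 xI bc xc kc)
  ?mulr_gt0 ?ltrD2l//; last 2 first.
- by lra.
- by lra.
rewrite (integral_quotient_profile_itv k0 xI bc xc kc)
  ?mulrNN ?mulr_gt0 ?ltrN2//; last 2 first.
- by lra.
- by lra.
have right_tail : (\int[mu]_(z in `[(a - x)%R, +oo[)
    (quotient_at (profile b a k) x z)%:E =
    ((1 - profile b a k x) / (a - x))%:E)%E.
  rewrite EFinM -integral_inv_sqr_ray// -ge0_integralZl//; last 2 first.
  - apply/measurable_EFinP; apply: measurable_funS (measurable_inv_sqr (ltW e0)) => //.
      exact: measurable_far (ltW e0).
    move=> z /=; rewrite in_itv/= andbT /far/= => az.
    by rewrite (lt_le_trans ea)// (le_trans az)// ler_norm.
  - by rewrite lee_fin subr_ge0; case/andP: (profile_itv x ba k0).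
  apply: eq_integral => z; rewrite inE/= in_itv/= andbT => az.
  by rewrite /quotient_at (profile_right ba k0 (_ : a <= x + z))//; lra.
have left_tail : (\int[mu]_(z in `]-oo, (- (x - b))%R])
    (quotient_at (profile b a k) x z)%:E =
    (- (profile b a k x / (x - b)))%:E)%E.
  rewrite EFinN EFinM -integral_inv_sqr_rayN// -ge0_integralZl//; last 2 first.
  - apply/measurable_EFinP; apply: measurable_funS (measurable_inv_sqr (ltW e0)) => //.
      exact: measurable_far (ltW e0).
    move=> z /=; rewrite in_itv/= /far/= => zb.
    by rewrite (lt_le_trans eb)// -normrN (le_trans _ (ler_norm _))// lerNr.
  - by rewrite lee_fin; case/andP: (profile_itv x ba k0).
  rewrite -integral_ge0N; last first.
    move=> z _; rewrite -EFinM lee_fin mulr_ge0 ?invr_ge0 ?exprn_ge0//.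
    by case/andP: (profile_itv x ba k0).
  apply: eq_integral => z; rewrite inE/= in_itv/= => zb.
  rewrite /quotient_at (profile_left k ba (_ : x + z <= b)); last by lra.
  by rewrite sub0r mulNr EFinN.
rewrite right_tail left_tail -!EFinD quotient_primitive_right//.
have -> : quotient_primitive b a k c x (- (x - b)) = - (profile b a k x / (x - b)).
  by rewrite opprB quotient_primitive_left// -(opprB x b) invrN mulrN.
by congr EFin; ring.
Qed.


(** Each logarithm diverges, but [Q (x - e)] and [Q (x + e)] both have size [|d| * e] to first
    order, so the divergent parts cancel. *)
Lemma ln_sqr_gap (Q : R -> R) x d : is_derive x 1 Q d -> d != 0 -> Q x = 0 ->
  ln (Q (x - e) * Q (x - e)) - ln (Q (x + e) * Q (x + e)) @[e --> 0^'+] --> (0 : R).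
Proof.
move=> dQ d0 Qx.
have dd0 : 0 < d * d by rewrite -expr2 lt_neqAle eq_sym expf_neq0//= sqr_ge0.
have cr := is_derive1_right dQ; have cl := is_derive1_left dQ.
have crr : (Q (x + e) - Q x) / e * ((Q (x + e) - Q x) / e) @[e --> 0^'+] --> d * d.
  exact: cvgM.
have cll : (Q (x - e) - Q x) / e * ((Q (x - e) - Q x) / e) @[e --> 0^'+] --> d * d.
  by rewrite -[d * d]mulrNN; exact: cvgM.
have cln := continuous_ln dd0.
have HB : ln ((Q (x - e) - Q x) / e * ((Q (x - e) - Q x) / e)) -
  ln ((Q (x + e) - Q x) / e * ((Q (x + e) - Q x) / e)) @[e --> 0^'+]
  --> ln (d * d) - ln (d * d).
  by apply: cvgB; apply: continuous_cvg.
rewrite subrr in HB; apply: cvg_trans HB.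
apply: near_eq_cvg; near=> e; rewrite /= Qx !subr0.
have e0 : 0 < e by near: e; exact: nbhs_right_gt.
have e20 : 0 < e * e by rewrite mulr_gt0.
have r0 : 0 < Q (x + e) / e * (Q (x + e) / e).
  have : 0 < (Q (x + e) - Q x) / e * ((Q (x + e) - Q x) / e).
    by near: e; exact: (cvgr_gt _ crr).
  by rewrite Qx subr0.
have l0 : 0 < Q (x - e) / e * (Q (x - e) / e).
  have : 0 < (Q (x - e) - Q x) / e * ((Q (x - e) - Q x) / e).
    by near: e; exact: (cvgr_gt _ cll).
  by rewrite Qx subr0.
(* Factoring out [e * e] isolates the common divergent term [ln (e * e)]. *)
have E (q : R) : q * q = q / e * (q / e) * (e * e) by field; rewrite gt_eqF.
rewrite (E (Q (x - e))) (E (Q (x + e))).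
by rewrite [X in _ = X - _]lnM ?posrE// [X in _ = _ - X]lnM ?posrE//; ring.
Unshelve. all: by end_near. Qed.

(** The profile values merge by continuity, the logarithms by [ln_sqr_gap], and the two one-sided
    difference quotients tend to opposite limits. This is the cancellation behind the principal
    value. *)
Lemma quotient_primitive_gap b a k c x : 0 < k -> b < x < a ->
  b != c -> x != c -> k ^+ 2 * (c - b) = c - a ->
  quotient_primitive b a k c x (- e) - quotient_primitive b a k c x e
    @[e --> 0^'+] --> (0 : R).
Proof.
move=> k0 xI bc xc kc; have /andP[bx xa] := xI.
have ba := lt_trans bx xa.
have t10 : 0 < Num.sqrt (x - b) by rewrite sqrtr_gt0 subr_gt0.
have t20 : 0 < Num.sqrt (a - x) by rewrite sqrtr_gt0 subr_gt0.
have K0 := divr_gt0 t20 t10.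
have dG := is_derive_profile k0 xI bc kc.
have dQ : is_derive x 1 (pole_ratio b a x) _ := is_derive_moebius K0 xI.
have d0 : Num.sqrt (a - x) / Num.sqrt (x - b) * (a - b) /
    (Num.sqrt (x - b) * Num.sqrt (a - x) *
     (Num.sqrt (a - x) / Num.sqrt (x - b) * Num.sqrt (x - b) + Num.sqrt (a - x)) ^+ 2)
   != 0.
  rewrite gt_eqF// divr_gt0// mulr_gt0// ?subr_gt0//; first exact: mulr_gt0.
  by rewrite exprn_gt0// moebius_den_gt0.
have Qx : pole_ratio b a x x = 0.
  by rewrite /pole_ratio /moebius divfK ?gt_eqF// subrr mul0r.
move: dG; set g := (X in is_derive _ _ _ X) => dG.
have H1 := is_derive1_left dG; have H2 := is_derive1_right dG.
have H3 := ln_sqr_gap dQ d0 Qx.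
have cG : {for x, continuous (profile b a k)} by exact: continuous_profile.
have id0 : e @[e --> (0:R)^'+] --> (0 : R) by apply: cvg_at_right_filter; exact: cvg_id.
have H4 : profile b a k (x - e) @[e --> 0^'+] --> profile b a k x.
  apply: continuous_cvg => //; rewrite -[X in _ --> X]subr0.
  by apply: cvgB => //; exact: cvg_cst.
have H5 : profile b a k (x + e) @[e --> 0^'+] --> profile b a k x.
  apply: continuous_cvg => //; rewrite -[X in _ --> X]addr0.
  by apply: cvgD => //; exact: cvg_cst.
pose C := k * (c - b) / (2 * pi * Num.sqrt (x - b) * Num.sqrt (a - x)).
have H6 : (c - x)^-1 * ((profile b a k (x - e) - profile b a k (x + e)) +
    C * (ln (pole_ratio b a x (x - e) * pole_ratio b a x (x - e)) -
         ln (pole_ratio b a x (x + e) * pole_ratio b a x (x + e)))) @[e --> 0^'+]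
    --> (c - x)^-1 * ((profile b a k x - profile b a k x) + C * 0).
  apply: cvgM; first exact: cvg_cst.
  by apply: cvgD; [exact: cvgB|apply: cvgM => //; exact: cvg_cst].
have H7 : (c - x)^-1 * ((profile b a k (x - e) - profile b a k (x + e)) +
    C * (ln (pole_ratio b a x (x - e) * pole_ratio b a x (x - e)) -
         ln (pole_ratio b a x (x + e) * pole_ratio b a x (x + e)))) +
    ((profile b a k (x - e) - profile b a k x) / e +
     (profile b a k (x + e) - profile b a k x) / e) @[e --> 0^'+]
    --> (c - x)^-1 * ((profile b a k x - profile b a k x) + C * 0) + (- g + g).
  by apply: cvgD => //; exact: cvgD.
rewrite subrr mulr0 addr0 mulr0 add0r addNr {H6} in H7; apply: cvg_trans H7.
apply: near_eq_cvg; near=> e.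
rewrite /quotient_primitive /= -/C invrN; ring.
Unshelve. all: by end_near. Qed.

Lemma half_laplacian_profile b a k c x : 0 < k -> b < x < a ->
  b != c -> x != c -> k ^+ 2 * (c - b) = c - a ->
  half_laplacian_is (profile b a k) x (pi^-1 / (c - x)).
Proof.
move=> k0 xI bc xc kc; have /andP[bx xa] := xI.
apply: half_laplacian_near.
  near=> e; apply: (integral_quotient_profile k0 xI bc xc kc).
  - by near: e; exact: nbhs_right_gt.
  - by near: e; apply: nbhs_right_lt; rewrite subr_gt0.
  - by near: e; apply: nbhs_right_lt; rewrite subr_gt0.
rewrite mulrA divff ?mul1r ?gt_eqF ?pi_gt0// -[X in _ --> X]addr0.
by apply: cvgD; [exact: cvg_cst|exact: quotient_primitive_gap].
Unshelve. all: by end_near. Qed.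

End ProfileLaplacian.

(** * Uniqueness *)

Section Barrier.
Context {R : realType}.
Implicit Types (a b c k x y z e : R) (u w : R -> R).

Lemma continuous_ray c y : y < c ->
  {for y, continuous (fun y : R => (c <= y)%R%:R : R)}.
Proof.
move=> yc; apply: cvg_near_cst; near=> z.
rewrite (leNgt c y) yc /= (leNgt c z); suff -> : z < c by [].
by near: z; exact: lt_nbhsl.
Unshelve. all: by end_near. Qed.

Lemma continuous_rayN c y : c < y ->
  {for y, continuous (fun y : R => (y <= c)%R%:R : R)}.
Proof.
move=> yc; apply: cvg_near_cst; near=> z.
rewrite (leNgt y c) yc /= (leNgt z c); suff -> : c < z by [].
by near: z; exact: lt_nbhsr.
Unshelve. all: by end_near. Qed.

(** The gain is the one that puts the pole of the profile on [(d, a)] at [b]. The values are 0 up to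
    [b], 1 on [(b, d]] and 0 from [a] on. *)
Definition barrier b d a y : R :=
  1 - profile d a (Num.sqrt ((a - b) / (d - b))) y - (y <= b)%R%:R.

Lemma barrier_gain b d a : b < d -> d < a ->
  0 < Num.sqrt ((a - b) / (d - b)) /\
  Num.sqrt ((a - b) / (d - b)) ^+ 2 * (b - d) = b - a.
Proof.
move=> bd da; have db0 : 0 < d - b by rewrite subr_gt0.
have ab0 : 0 < a - b by rewrite subr_gt0 (lt_trans bd).
split; first by rewrite sqrtr_gt0 divr_gt0.
rewrite sqr_sqrtr; last by rewrite divr_ge0// ltW.
by field; rewrite gt_eqF.
Qed.

Lemma bounded_measurable_barrier b d a : b < d -> d < a ->
  bounded_measurable (barrier b d a).
Proof.
move=> bd da; have [k0 _] := barrier_gain bd da.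
apply: bounded_measurableB; last exact: bounded_measurable_rayN.
apply: bounded_measurableB; first exact: bounded_measurable_cst.
exact: bounded_measurable_profile.
Qed.

Lemma half_laplacian_barrier b d a x : b < d -> d < x < a ->
  half_laplacian_is (barrier b d a) x 0.
Proof.
move=> bd /andP[dx xa]; have da := lt_trans dx xa.
have [k0 kb] := barrier_gain bd da.
have bx := lt_trans bd dx.
have -> : 0 = 0 - pi^-1 / (b - x) - pi^-1 / (x - b) :> R.
  by rewrite -(opprB x b) invrN mulrN opprK add0r subrr.
have bp := bounded_measurable_profile da k0.
have b1 := bounded_measurable_cst (1 : R).
apply: half_laplacianB (half_laplacian_rayN bx) => //.
- exact: bounded_measurableB.
- exact: bounded_measurable_rayN.
- apply: half_laplacianB (half_laplacian_cst _ _) _ => //.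
  apply: half_laplacian_profile => //; first by rewrite dx.
    by rewrite gt_eqF.
  by rewrite gt_eqF.
Qed.

Lemma barrier_tends0 b a y : b < y < a -> barrier b d a y @[d --> b^'+] --> (0 : R).
Proof.
move=> /andP[yb ya]; have ab0 : 0 < a - b by rewrite subr_gt0 (lt_trans yb).
(* This is [profileCE] with the gain inserted; it is continuous at [d = b], where the factor
   [Num.sqrt (d - b)] makes it vanish. *)
pose f d := 2 / pi * atan (Num.sqrt (a - y) / Num.sqrt (a - b) *
   (Num.sqrt (d - b) / Num.sqrt (y - d))).
have fb : f b = 0 by rewrite /f subrr sqrtr0 mul0r mulr0 atan0 mulr0.
have cf : f d @[d --> b^'+] --> f b.
  apply: cvg_at_right_filter; apply: cvgM; first exact: cvg_cst.
  apply: continuous_cvg; first exact: continuous_atan.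
  apply: cvgM; first exact: cvg_cst.
  apply: cvgM; first exact: continuous_sqrt_subr.
  apply: cvgV; last exact: continuous_sqrt_subl.
  by rewrite gt_eqF// sqrtr_gt0 subr_gt0.
rewrite fb in cf; apply: cvg_trans cf; apply: near_eq_cvg; near=> d.
have bd : b < d by near: d; exact: nbhs_right_gt.
have dy : d < y by near: d; exact: nbhs_right_lt.
have [k0 _] := barrier_gain bd (lt_trans dy ya).
rewrite /barrier profileCE ?dy// (leNgt y) yb subr0 /f; congr (_ * atan _).
have db0 : 0 < d - b by rewrite subr_gt0.
rewrite sqrtrM ?(ltW ab0)// sqrtrV ?(ltW db0)//; field.
by rewrite !gt_eqF// sqrtr_gt0// subr_gt0.
Unshelve. all: by end_near. Qed.

(* The maximum principle without continuity at [b]: the barrier, which equals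
   [1] next to [b], absorbs a possible jump there. *)
Lemma bounded_maximum_principle w b a : bounded_measurable w ->
  (forall y, w y <= 1) -> (forall y, ~~ (b < y < a) -> w y = 0) ->
  (forall y, b < y <= a -> {for y, continuous w}) ->
  (forall x, b < x < a -> half_laplacian_is w x 0) ->
  forall y, w y <= 0.
Proof.
move=> bw w1 w_out cw hw y.
have [yI|/w_out ->//] := boolP (b < y < a); have /andP[yb ya] := yI.
have cmp d : b < d -> d < a -> w y <= barrier b d a y.
  move=> bd da; have [k0 kb] := barrier_gain bd da.
  rewrite -subr_le0; apply: (@maximum_principle _ (fun y => w y - barrier b d a y) d a).
  - by apply: bounded_measurableB => //; exact: bounded_measurable_barrier.
  - exact: ltW.
  - apply: continuous_in_subspaceT => z; rewrite inE/= in_itv/= => /andP[dz za].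
    have bz := lt_le_trans bd dz.
    apply: cvgB; first by apply: cw; rewrite bz.
    apply: cvgB; last exact: continuous_rayN.
    by apply: cvgB; [exact: cvg_cst|exact: continuous_profile].
  - move=> z; rewrite negb_and -!leNgt => zI; rewrite subr_le0 /barrier.
    (* Outside [(d, a)] both functions vanish up to [b] and from [a] on, while on [(b, d]] the
       barrier is 1 and [w <= 1]. Continuity of [w] is thus asked on [[d, a]] only. *)
    have [zb|bz] := leP z b.
      rewrite profile_left ?(le_trans zb (ltW bd))// subr0 subrr w_out//.
      by rewrite ltNge zb.
    case/orP: zI => [zd|az]; first by rewrite profile_left// !subr0.
    by rewrite profile_right// subrr subr0 w_out// negb_and -!leNgt az orbT.
  - move=> x xI; rewrite -(subr0 0); apply: half_laplacianB => //.
    + exact: bounded_measurable_barrier.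
    + by apply: hw; case/andP: xI => dx ->; rewrite (lt_trans bd).
    + exact: half_laplacian_barrier.
rewrite leNgt; apply/negP => wy0.
(* For [d] close to [b] the barrier at the fixed point [y] drops below the supposed positive value
   [w y]. *)
near b^'+ => d.
have : barrier b d a y < w y by near: d; exact: (cvgr_lt _ (barrier_tends0 yI)).
rewrite ltNge cmp//.
by near: d; apply: nbhs_right_lt; rewrite (lt_trans yb).
Unshelve. all: by end_near. Qed.

End Barrier.

(** * The solution for a given free boundary point: uniqueness and normal derivative *)

Section Solution.
Context {R : realType}.
Implicit Types (a b c k x y z e : R) (u w : R -> R).

(** This is the positive root of [k ^+ 2 * (c - b) = c - a], placing the pole at [c]. *)
Definition gain b a c : R := Num.sqrt ((c - a) / (c - b)).

Definition solution b a c y : R := profile b a (gain b a c) y - (c <= y)%R%:R.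

Lemma gain_gt0 b a c : b < a -> a < c -> 0 < gain b a c.
Proof.
by move=> ba ac; rewrite sqrtr_gt0 divr_gt0// subr_gt0// (lt_trans ba).
Qed.

Lemma gainE b a c : b < a -> a < c -> gain b a c ^+ 2 * (c - b) = c - a.
Proof.
move=> ba ac; have cb : 0 < c - b by rewrite subr_gt0 (lt_trans ba).
rewrite sqr_sqrtr ?divfK ?gt_eqF// divr_ge0 ?(ltW cb)//.
by rewrite subr_ge0 ltW.
Qed.

Lemma solution_left b a c y : b < a -> a < c -> y <= b -> solution b a c y = 0.
Proof.
move=> ba ac yb; rewrite /solution profile_left//.
by rewrite leNgt (le_lt_trans yb) ?subr0// (lt_trans ba).
Qed.

Lemma solution_mid b a c y : b < a -> a <= y -> y < c -> solution b a c y = 1.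
Proof.
move=> ba ay yc; have ac := le_lt_trans ay yc.
rewrite /solution profile_right ?gain_gt0//.
by rewrite leNgt yc subr0.
Qed.

Lemma solution_right b a c y : b < a -> a < c -> c <= y -> solution b a c y = 0.
Proof.
move=> ba ac cy; rewrite /solution profile_right ?gain_gt0//.
  by rewrite cy subrr.
exact: le_trans (ltW ac) cy.
Qed.

Lemma solution_itv b a c y : b < a -> a < c -> 0 <= solution b a c y <= 1.
Proof.
move=> ba ac; have [cy|yc] := leP c y; first by rewrite solution_right// lexx ler01.
by rewrite /solution (leNgt c) yc subr0 profile_itv// gain_gt0.
Qed.

Lemma bounded_measurable_solution b a c : b < a -> a < c ->
  bounded_measurable (solution b a c).
Proof.
move=> ba ac; apply: bounded_measurableB; last exact: bounded_measurable_ray.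
by apply: bounded_measurable_profile => //; exact: gain_gt0.
Qed.

Lemma continuous_solution b a c y : b < a -> a < c -> y < c ->
  {for y, continuous (solution b a c)}.
Proof.
move=> ba ac yc; apply: cvgB; last exact: continuous_ray.
by apply: continuous_profile => //; exact: gain_gt0.
Qed.

Lemma half_laplacian_solution b a c x : a < c -> b < x < a ->
  half_laplacian_is (solution b a c) x 0.
Proof.
move=> ac /andP[bx xa]; have ba := lt_trans bx xa.
have k0 := gain_gt0 ba ac; have xc := lt_trans xa ac.
rewrite -(subrr (pi^-1 / (c - x))); apply: half_laplacianB.
- exact: bounded_measurable_profile.
- exact: bounded_measurable_ray.
- apply: half_laplacian_profile; rewrite ?bx ?lt_eqF ?(lt_trans ba)//.
  exact: gainE.
- exact: half_laplacian_ray.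
Qed.

Lemma solutionE b a c y : b < a -> a < c -> b < y < a ->
  solution b a c y = 2 / pi * atan (Num.sqrt (y - b) * Num.sqrt (c - a) /
    (Num.sqrt (a - y) * Num.sqrt (c - b))).
Proof.
move=> ba ac yI; have k0 := gain_gt0 ba ac; have /andP[yb ya] := yI.
rewrite /solution (leNgt c) (lt_trans ya ac) subr0 profileE//.
congr (_ * atan _).
have cb : 0 < c - b by rewrite subr_gt0 (lt_trans ba).
have ca : 0 < c - a by rewrite subr_gt0.
rewrite /gain sqrtrM ?(ltW ca)// sqrtrV ?(ltW cb)//; field.
by rewrite !gt_eqF// sqrtr_gt0// subr_gt0.
Qed.

(** Both differences satisfy the maximum principle that tolerates a jump at [b]. Continuity at [a]
    is included in that on [(b, c)], since [a < c]. *)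
Lemma solution_unique b a c u : b < a -> a < c ->
  measurable_fun [set: R] u -> (forall y, 0 <= u y <= 1) ->
  (forall y, b < y < c -> {for y, continuous u}) ->
  (forall x, b < x < a -> half_laplacian_is u x 0) ->
  (forall y, a <= y -> y < c -> u y = 1) ->
  (forall y, ~~ (b < y < c) -> u y = 0) ->
  u = solution b a c.
Proof.
move=> ba ac mu uI cu hu u1 u0.
have bu : bounded_measurable u.
  by split=> //; exists 1 => y; have /andP[u0y u1y] := uI y; rewrite ger0_norm.
have bs := bounded_measurable_solution ba ac.
have out y : ~~ (b < y < a) -> u y = solution b a c y.
  rewrite negb_and -!leNgt => /orP[yb|ay].
    by rewrite u0 ?solution_left// ltNge yb.
  have [cy|yc] := leP c y; last by rewrite u1 ?solution_mid.
  by rewrite u0 ?solution_right// negb_and -!leNgt cy orbT.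
have cs y : b < y <= a -> {for y, continuous (solution b a c)}.
  by move=> /andP[_ ya]; apply: continuous_solution => //; exact: le_lt_trans ac.
have cu' y : b < y <= a -> {for y, continuous u}.
  by move=> /andP[yb ya]; apply: cu; rewrite yb (le_lt_trans ya).
have hs x : b < x < a -> half_laplacian_is (solution b a c) x 0.
  exact: half_laplacian_solution.
apply/funext => y; apply/eqP; rewrite eq_le; apply/andP; split.
- rewrite -subr_le0.
  apply: (@bounded_maximum_principle _ (fun y => u y - solution b a c y) b a).
  + exact: bounded_measurableB.
  + move=> z; have /andP[_ uz] := uI z; have /andP[sz _] := solution_itv z ba ac; lra.
  + by move=> z /out ->; rewrite subrr.
  + by move=> z zI; apply: cvgB; [exact: cu'|exact: cs].
  + move=> x xI; rewrite -(subr0 0).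
    by apply: half_laplacianB => //; [exact: hu|exact: hs].
- rewrite -subr_le0.
  apply: (@bounded_maximum_principle _ (fun y => solution b a c y - u y) b a).
  + exact: bounded_measurableB.
  + move=> z; have /andP[uz _] := uI z; have /andP[_ sz] := solution_itv z ba ac; lra.
  + by move=> z /out ->; rewrite subrr.
  + by move=> z zI; apply: cvgB; [exact: cs|exact: cu'].
  + move=> x xI; rewrite -(subr0 0).
    by apply: half_laplacianB => //; [exact: hs|exact: hu].
Qed.

(** It allows composing with the limit of [atan q / q], which is taken from the right. *)
Lemma cvg_at_right0 (p : R -> R) (F : set_system R) {FF : Filter F} :
  p e @[e --> F] --> (0 : R) -> (\forall e \near F, 0 < p e) ->
  p e @[e --> F] --> (0 : R)^'+.
Proof.
move=> p0 ppos A A0; have H := p0 _ A0.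
by apply: filterS2 ppos H => e pe; exact.
Qed.

Lemma atan_div_cvg1 : atan q / q @[q --> (0 : R)^'+] --> (1 : R).
Proof.
have H := is_derive1_right (is_derive1_atan (0 : R)).
rewrite expr0n/= addr0 invr1 in H; apply: cvg_trans H.
by apply: near_eq_cvg; apply: nearW => e; rewrite /= add0r atan0 subr0.
Qed.

Definition slope b a c : R := 2 / pi / (gain b a c * Num.sqrt (a - b)).

(** By [profileCE], [1 - solution (a - t)] is [2 / pi * atan (p t)] with
    [p t = sqrt t / (k * sqrt (a - t - b))]; as [atan] is equivalent to its argument at 0, dividing
    by [sqrt t] leaves the value of the second factor at [t = 0]. *)
Lemma solution_normal_derivative b a c : b < a -> a < c ->
  half_normal_derivative_is (solution b a c) a (- slope b a c).
Proof.
move=> ba ac; have k0 := gain_gt0 ba ac.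
set k := gain b a c in k0 *.
have ab0 : 0 < Num.sqrt (a - b) by rewrite sqrtr_gt0 subr_gt0.
pose q t := (k * Num.sqrt (a - t - b))^-1.
have qa : q t @[t --> 0^'+] --> (k * Num.sqrt (a - b))^-1.
  rewrite -[X in (k * Num.sqrt (X - b))^-1]subr0.
  apply: (@cvg_at_right_filter _ _ q 0 (q 0)).
  apply: cvgV; first by rewrite subr0 mulf_neq0 ?gt_eqF.
  apply: cvgM; first exact: cvg_cst.
  apply: continuous_cvg; first exact: sqrt_continuous.
  apply: cvgB; last exact: cvg_cst.
  by apply: cvgB; [exact: cvg_cst|exact: cvg_id].
pose p t := Num.sqrt t * q t.
have s0 : Num.sqrt t @[t --> 0^'+] --> (0 : R).
  by rewrite -[X in _ --> X]sqrtr0; apply: cvg_at_right_filter; exact: sqrt_continuous.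
have p0 : p t @[t --> 0^'+] --> (0 : R).
  by rewrite -[X in _ --> X](mul0r (k * Num.sqrt (a - b))^-1); exact: cvgM.
have ppos : \forall t \near 0^'+, 0 < p t.
  near=> t; have t0 : 0 < t by near: t; exact: nbhs_right_gt.
  have tb : t < a - b by near: t; apply: nbhs_right_lt; rewrite subr_gt0.
  have sq0 : 0 < Num.sqrt (a - t - b) by rewrite sqrtr_gt0; lra.
  by rewrite mulr_gt0// ?sqrtr_gt0// invr_gt0 mulr_gt0.
have H1 : atan (p t) / p t @[t --> 0^'+] --> (1 : R).
  apply: (@cvg_comp _ _ _ p (fun q => atan q / q)); last exact: atan_div_cvg1.
  exact: (cvg_at_right0 p0 ppos).
have H2 : - (2 / pi * ((atan (p t) / p t) * q t)) @[t --> 0^'+]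
    --> - (2 / pi * (1 * (k * Num.sqrt (a - b))^-1)).
  apply: cvgN; apply: cvgM; first exact: cvg_cst.
  exact: cvgM.
rewrite mul1r in H2; apply: cvg_trans H2; apply: near_eq_cvg; near=> t.
have t0 : 0 < t by near: t; exact: nbhs_right_gt.
have tb : t < a - b by near: t; apply: nbhs_right_lt; rewrite subr_gt0.
have st0 : 0 < Num.sqrt t by rewrite sqrtr_gt0.
have sq0 : 0 < Num.sqrt (a - t - b) by rewrite sqrtr_gt0; lra.
rewrite (@solution_mid b a c a)// /solution (leNgt c).
have -> : a - t < c by lra.
rewrite subr0 -opprB profileCE//; last by apply/andP; split; lra.
rewrite -/k (_ : a - (a - t) = t); last by ring.
rewrite mulNr; congr (- _); rewrite -/(q t) /p.
move: (2 / pi : R) (atan _) => P A; rewrite /q; field.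
by rewrite !gt_eqF.
Unshelve. all: by end_near. Qed.

End Solution.

(** * The free-boundary condition *)

Section Characterization.
Context {R : realType}.
Implicit Types (a b c x y : R).

(** The interval is a ball around its midpoint, and balls close up to closed balls. *)
Lemma closure_itvoo a c : a < c -> closure `]a, c[ = `[a, c]%classic.
Proof.
move=> ac.
have aE : (a + c) / 2 - (c - a) / 2 = a by field.
have cE : (a + c) / 2 + (c - a) / 2 = c by field.
have -> : `]a, c[%classic = ball ((a + c) / 2) ((c - a) / 2).
  by rewrite ball_itv aE cE.
by rewrite closure_ballE closed_ball_itv ?aE ?cE// divr_gt0// subr_gt0.
Qed.

Lemma itvoo_left_inj a a' c : a < c -> a' < c ->
  `]a, c[%classic = `]a', c[%classic -> a = a'.
Proof.
have aux p p' : p < c -> p < p' -> `]p, c[%classic <> `]p', c[%classic.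
  move=> pc pp' /seteqP[sub _].
  (* This point lies in the longer interval but to the left of [p']. *)
  pose m := (p + Num.min p' c) / 2.
  have h1 : Num.min p' c <= p' by rewrite ge_min lexx.
  have h2 : Num.min p' c <= c by rewrite ge_min lexx orbT.
  have h3 : p < Num.min p' c by rewrite lt_min pp' pc.
  have : m \in `]p', c[ by apply: sub; rewrite /= in_itv/= /m; apply/andP; split; lra.
  by rewrite in_itv/= /m => /andP[]; lra.
move=> ac a'c E; have [lt|lt|//] := ltgtP a a'.
- by have := aux _ _ ac lt E.
- by have := aux _ _ a'c lt (esym E).
Qed.

Lemma card_set2 (T : Type) (p q : T) : p <> q -> ([set p; q] #= `I_2)%card.
Proof.
move=> pq; apply/eq_cardSP; exists p; first by left.
rewrite (_ : _ `\ p = [set q]) ?card_set1//.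
apply/seteqP; split => [z [[->|->]]//|z ->]; first by case.
by split; [right|exact/nesym].
Qed.

(** * The solution set for each [lambda] on a fixed interval *)

Section Fixed.
Variables (x0 r : R) (r_gt0 : 0 < r).
Local Notation b := (x0 - r).
Local Notation c := (x0 + r).

Let bc : b < c.
Proof. by move: r_gt0; lra. Qed.

(** The conditions other than the normal derivative determine [u] from [a]; uniqueness of limits
    then turns the last one into an equation between [lambda] and [a]. *)
Lemma bernoulli_solutionP lambda (u : R -> R) (K : set R) :
  bernoulli_solution x0 r lambda u K <->
  exists a, [/\ b < a < c, K = `]a, c[%classic, u = solution b a c &
                lambda = slope b a c].
Proof.
rewrite /bernoulli_solution; split.
- move=> [mu uI cu [a [[ac KE KD]] [hu u1 u0 ua]]].
  have b_le_a : b <= a.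
    (* If [a < b], the midpoint of [a] and [b] would lie in [K] but outside [D]. *)
    rewrite leNgt; apply/negP => ab.
    have : (`]b, c[%classic : set R) ((a + b) / 2).
      by apply: KD; rewrite KE /= in_itv/=; apply/andP; split; move: ac bc; lra.
    by rewrite /= in_itv/= => /andP[]; lra.
  have clK : closure K = `[a, c]%classic by rewrite KE closure_itvoo.
  have u1' y : a <= y -> y < c -> u y = 1.
    move=> ay yc; apply: u1; rewrite clK; split => /=.
      by rewrite in_itv/= ay ltW.
    by move=> yE; move: yc; rewrite yE ltxx.
  have u0' y : ~~ (b < y < c) -> u y = 0.
    by move=> yD; apply: u0 => /=; rewrite in_itv/=; exact/negP.
  (* At [a = b] the value of [u] would be both 1, from [K], and 0, from the complement of [D]. *)
  have ba : b < a.
    rewrite lt_neqAle b_le_a andbT; apply/eqP => ab.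
    have := u1' a (lexx _) ac; rewrite u0' ?ab ?ltxx// => /eqP.
    by rewrite eq_sym oner_eq0.
  have cu' y : b < y < c -> {for y, continuous u}.
    move=> yD; move: cu; rewrite continuous_open_subspace; last exact: itv_open.
    by apply; rewrite inE/= in_itv.
  have hu' x : b < x < a -> half_laplacian_is u x 0.
    move=> /andP[bx xa]; apply: hu; rewrite clK; split => /=; rewrite in_itv/=.
      by rewrite bx (lt_trans xa).
    by rewrite leNgt xa.
  have uE := solution_unique ba ac mu uI cu' hu' u1' u0'.
  exists a; split => //; first by rewrite ba.
  have := solution_normal_derivative ba ac; rewrite -uE => ua'.
  by apply: oppr_inj; apply: (cvg_unique _ ua ua').
- move=> [a [/andP[ba ac] -> -> ->]].
  have [ms _] := bounded_measurable_solution ba ac.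
  split => //.
  + by move=> x; exact: solution_itv.
  + rewrite continuous_open_subspace; last exact: itv_open.
    move=> y; rewrite inE/= in_itv/= => /andP[_ yc].
    exact: continuous_solution.
  + exists a; split; split => //.
    * move=> z /=; rewrite !in_itv/= => /andP[az ->]; rewrite andbT.
      exact: lt_trans az.
    * move=> x; rewrite closure_itvoo// => -[] /=; rewrite !in_itv/=.
      move=> /andP[bx xc] /negP; rewrite negb_and -!ltNge => /orP[xa|].
        by apply: half_laplacian_solution => //; rewrite bx.
      by rewrite ltNge (ltW xc).
    * move=> x; rewrite closure_itvoo// => -[] /=; rewrite in_itv/=.
      move=> /andP[ax xc] /eqP xnc; apply: solution_mid => //.
      by rewrite lt_neqAle xnc.
    * move=> x /=; rewrite in_itv/= => /negP; rewrite negb_and -!leNgt.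
      by move=> /orP[xb|cx]; [exact: solution_left|exact: solution_right].
    * exact: solution_normal_derivative.
Qed.

Local Notation mu := (2 * Num.sqrt 2 / (pi * Num.sqrt r) : R).

Lemma mu_gt0 : 0 < mu.
Proof. by rewrite divr_gt0 ?mulr_gt0 ?pi_gt0 ?sqrtr_gt0. Qed.

Lemma slope_gt0 a : b < a < c -> 0 < slope b a c.
Proof.
move=> /andP[ba ac]; rewrite divr_gt0 ?divr_gt0 ?pi_gt0//.
by rewrite mulr_gt0 ?gain_gt0// sqrtr_gt0 subr_gt0.
Qed.

(** Since [r ^+ 2 - (a - x0) ^+ 2 = (c - a) * (a - b)] and [c - b = 2 * r], both sides equal
    [8 * r / pi ^+ 2]. *)
Lemma slope_sqr a : b < a < c ->
  slope b a c ^+ 2 * (r ^+ 2 - (a - x0) ^+ 2) = mu ^+ 2 * r ^+ 2.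
Proof.
move=> /andP[ba ac].
have -> : r ^+ 2 - (a - x0) ^+ 2 = (c - a) * (a - b) by ring.
have ab0 : 0 < a - b by rewrite subr_gt0.
have ca0 : 0 < c - a by rewrite subr_gt0.
have cbE : c - b = 2 * r by ring.
rewrite /slope /gain cbE !exprMn !exprVn !exprMn.
rewrite !sqr_sqrtr ?(ltW r_gt0) ?(ltW ab0)//; last first.
  by rewrite divr_ge0 ?(ltW ca0)// mulr_ge0// ltW.
move: (@pi R) (lt0r_neq0 (pi_gt0 R)) => p p0; field.
by rewrite p0 !gt_eqF.
Qed.

(** Squaring the equation loses nothing, because [lambda] and the slope are both positive. *)
Lemma slopeP lambda a : 0 < lambda -> b < a < c ->
  lambda = slope b a c <-> (a - x0) ^+ 2 = r ^+ 2 * (1 - mu ^+ 2 / lambda ^+ 2).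
Proof.
move=> l0 aI; have s0 := slope_gt0 aI; have sE := slope_sqr aI.
have D0 : r ^+ 2 - (a - x0) ^+ 2 != 0.
  have -> : r ^+ 2 - (a - x0) ^+ 2 = (c - a) * (a - b) by ring.
  by case/andP: aI => ba ac; rewrite mulf_neq0// gt_eqF// subr_gt0.
split => [lE|aE].
- rewrite -lE in sE.
  have -> : mu ^+ 2 = lambda ^+ 2 * (r ^+ 2 - (a - x0) ^+ 2) / r ^+ 2.
    by rewrite sE mulfK// expf_neq0// gt_eqF.
  by field; rewrite !gt_eqF.
- apply: (@pexpIrn _ 2) => //; rewrite ?nnegrE ?(ltW l0) ?(ltW s0)//.
  apply: (mulIf D0); rewrite sE aE; move: (mu ^+ 2) => M; field.
  by rewrite gt_eqF.
Qed.

Lemma half_width lambda : mu <= lambda ->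
  0 <= Num.sqrt (1 - mu ^+ 2 / lambda ^+ 2) < 1 /\
  Num.sqrt (1 - mu ^+ 2 / lambda ^+ 2) ^+ 2 = 1 - mu ^+ 2 / lambda ^+ 2.
Proof.
move=> ml; have m0 := mu_gt0; have l0 := lt_le_trans m0 ml.
have q1 : mu ^+ 2 / lambda ^+ 2 <= 1.
  by rewrite ler_pdivrMr ?exprn_gt0// mul1r lerXn2r ?nnegrE// ltW.
have q0 : 0 < mu ^+ 2 / lambda ^+ 2 by rewrite divr_gt0 ?exprn_gt0.
split; last by rewrite sqr_sqrtr// subr_ge0.
rewrite sqrtr_ge0/= -[ltRHS]sqrtr1 ltr_sqrt//; lra.
Qed.

(** The roots of the quadratic equation lie in [D] because the square root is below 1. At
    [lambda = mu] they coincide and the pair collapses to one solution. *)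
Lemma bernoulli_solutionsE lambda : mu <= lambda ->
  let s := Num.sqrt (1 - mu ^+ 2 / lambda ^+ 2) in
  let sol a := (solution b a c, `]a, c[%classic) in
  bernoulli_solutions x0 r lambda = [set sol (x0 - r * s); sol (x0 + r * s)].
Proof.
move=> ml s sol; have m0 := mu_gt0; have l0 := lt_le_trans m0 ml.
have [/andP[s0 s1] sE] := half_width ml; rewrite -/s in s0 s1 sE.
have rs0 : 0 <= r * s by rewrite mulr_ge0// ltW.
have rs1 : r * s < r by rewrite gtr_pMr.
have I1 : b < x0 - r * s < c by apply/andP; split; lra.
have I2 : b < x0 + r * s < c by apply/andP; split; lra.
apply/seteqP; split => [[u K] /bernoulli_solutionP[a [aI /= -> -> lE]]|].
- have := (slopeP l0 aI).1 lE; rewrite -sE -exprMn => /eqP.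
  rewrite eqf_sqr => /orP[/eqP aE|/eqP aE]; [right|left]; rewrite /sol.
    by have -> : a = x0 + r * s by lra.
  by have -> : a = x0 - r * s by lra.
- move=> p [->|->]; apply/bernoulli_solutionP.
    exists (x0 - r * s); split => //; apply/slopeP => //.
    by rewrite -sE; ring.
  exists (x0 + r * s); split => //; apply/slopeP => //.
  by rewrite -sE; ring.
Qed.

(** Here the quadratic equation would give a square a negative value. *)
Lemma bernoulli_solutions_lt lambda : 0 < lambda < mu ->
  bernoulli_solutions x0 r lambda = set0.
Proof.
move=> /andP[l0 lm]; apply/seteqP; split => // -[u K].
move=> /bernoulli_solutionP[a [aI _ _ lE]].
have := (slopeP l0 aI).1 lE; move: (sqr_ge0 (a - x0)) => /[swap] ->.
rewrite pmulr_rge0 ?exprn_gt0// subr_ge0 ler_pdivrMr ?exprn_gt0// mul1r.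
by rewrite leNgt ltrXn2r// ?nnegrE// ltW.
Qed.

Lemma bernoulli_solutions_eq :
  bernoulli_solutions x0 r mu = [set (solution b x0 c, `]x0, c[%classic)].
Proof.
rewrite bernoulli_solutionsE// divff; last by rewrite expf_neq0// gt_eqF// mu_gt0.
by rewrite subrr sqrtr0 mulr0 subr0 addr0 setUid.
Qed.

Lemma half_width_gt0 lambda : mu < lambda ->
  0 < Num.sqrt (1 - mu ^+ 2 / lambda ^+ 2).
Proof.
move=> ml; have m0 := mu_gt0; have l0 := lt_trans m0 ml.
rewrite sqrtr_gt0 subr_gt0 ltr_pdivrMr ?exprn_gt0// mul1r.
by rewrite ltrXn2r// ?nnegrE// ltW.
Qed.

Lemma solution_pair_neq s : 0 < s -> s < 1 ->
  (solution b (x0 - r * s) c, `]x0 - r * s, c[%classic) <>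
  (solution b (x0 + r * s) c, `]x0 + r * s, c[%classic).
Proof.
move=> s0 s1 [_ E].
have rs0 : 0 < r * s by rewrite mulr_gt0.
have rs1 : r * s < r by rewrite gtr_pMr.
by have /(_ _ _ E) := @itvoo_left_inj (x0 - r * s) (x0 + r * s) c; lra.
Qed.

Lemma is_bernoulli_constant_mu : is_bernoulli_constant x0 r mu.
Proof.
split.
- exact: mu_gt0.
- move=> lambda ml; rewrite bernoulli_solutionsE ?ltW//; apply: card_set2.
  have [/andP[_ s1] _] := half_width (ltW ml).
  exact: solution_pair_neq (half_width_gt0 ml) s1.
- by rewrite bernoulli_solutions_eq card_set1.
- exact: bernoulli_solutions_lt.
Qed.

(** Two different constants would disagree at their midpoint, where one demands two solutions and
    the other none. *)
Lemma is_bernoulli_constantP m : is_bernoulli_constant x0 r m <-> m = mu.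
Proof.
split => [[m0 m_two _ m_none]|->]; last exact: is_bernoulli_constant_mu.
have [mu0 mu_two _ mu_none] := is_bernoulli_constant_mu.
have clash l : (bernoulli_solutions x0 r l #= `I_2)%card ->
    bernoulli_solutions x0 r l <> set0.
  by move=> /[swap] ->; rewrite card_eq_sym card_eq0 => /eqP/seteqP[/(_ 0%N)/(_ isT)].
have [lt|lt|//] := ltgtP m mu.
- exfalso; apply: (clash ((m + mu) / 2)); first by apply: m_two; lra.
  by apply: mu_none; apply/andP; split; lra.
- exfalso; apply: (clash ((m + mu) / 2)); first by apply: mu_two; lra.
  by apply: m_none; apply/andP; split; lra.
Qed.

End Fixed.
End Characterization.

Lemma solution_formula (R : realType) (b a c x : R) : b < a -> a < c ->
  (`]b, c[ `\` closure `]a, c[) x ->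
  solution b a c x = 2 / pi * atan (Num.sqrt (x - b) * Num.sqrt (c - a) /
    (Num.sqrt (a - x) * Num.sqrt (c - b))).
Proof.
move=> ba ac; rewrite closure_itvoo// => -[] /=; rewrite !in_itv/=.
move=> /andP[bx xc] /negP; rewrite negb_and -!ltNge => /orP[xa|].
  by apply: solutionE => //; rewrite bx.
by rewrite ltNge (ltW xc).
Qed.

Theorem theorem1p4 (R : realType) (x0 r : R) (r_gt0 : 0 < r) :
  let D : set R := `]x0 - r, x0 + r[%classic in
  let mu : R := 2 * Num.sqrt 2 / (pi * Num.sqrt r) in
  [/\ forall m : R, is_bernoulli_constant x0 r m <-> m = mu,
      (let K : set R := `]x0, x0 + r[%classic in
       exists u : R -> R,
         bernoulli_solutions x0 r mu = [set (u, K)] /\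
         forall x, (D `\` closure K) x ->
           u x = 2 / pi *
             atan (Num.sqrt (x - x0 + r) / Num.sqrt (2 * (x0 - x)))) &
      forall lambda : R, mu < lambda ->
        let a (i : nat) : R :=
          x0 + (-1) ^+ i * r * Num.sqrt (1 - mu ^+ 2 / lambda ^+ 2) in
        let K (i : nat) : set R := `]a i, x0 + r[%classic in
        exists u : nat -> R -> R,
          [/\ (u 1%N, K 1%N) <> (u 2%N, K 2%N),
              bernoulli_solutions x0 r lambda =
                [set (u 1%N, K 1%N); (u 2%N, K 2%N)] &
              forall i : nat, (1 <= i <= 2)%N ->
                forall x, (D `\` closure (K i)) x ->
                  u i x = 2 / pi *
                    atan ((Num.sqrt (x - x0 + r) * Num.sqrt (x0 + r - a i)) /
                          (Num.sqrt (a i - x) * Num.sqrt (2 * r)))]].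
Proof.
move=> D mu; have cbE : x0 + r - (x0 - r) = 2 * r by ring.
have xbE x : x - x0 + r = x - (x0 - r) by ring.
split.
- exact: is_bernoulli_constantP.
- exists (solution (x0 - r) x0 (x0 + r)); split; first exact: bernoulli_solutions_eq.
  have bx0 : x0 - r < x0 by lra.
  have x0c : x0 < x0 + r by lra.
  move=> x Dx; rewrite solution_formula// cbE xbE; congr (_ * atan _).
  (* At [a = x0] the factor [sqrt (c - a) = sqrt r] cancels against [sqrt (2 * r)], leaving the
     [sqrt 2] of the stated formula. *)
  have r0 : 0 < Num.sqrt r by rewrite sqrtr_gt0.
  rewrite (_ : x0 + r - x0 = r); last by ring.
  rewrite !sqrtrM// !invfM; move: (Num.sqrt (x0 - x))^-1 (Num.sqrt 2)^-1 => p q.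
  by field; rewrite gt_eqF.
- move=> lambda ml a K; set s := Num.sqrt (1 - mu ^+ 2 / lambda ^+ 2) in a K *.
  have [/andP[s0 s1] _] := half_width r_gt0 (ltW ml).
  have s_gt0 := half_width_gt0 r_gt0 ml.
  rewrite -/mu -/s in s0 s1 s_gt0.
  have rs0 : 0 < r * s by rewrite mulr_gt0.
  have rs1 : r * s < r by rewrite gtr_pMr.
  (* The sign [(-1) ^+ i] makes index 1 the left root and index 2 the right one. *)
  have a1 : a 1%N = x0 - r * s by rewrite /a expr1 mulN1r mulNr.
  have a2 : a 2%N = x0 + r * s by rewrite /a sqrrN expr1n mul1r.
  exists (fun i => solution (x0 - r) (a i) (x0 + r)); rewrite /K a1 a2; split.
  + exact: solution_pair_neq.
  + by rewrite bernoulli_solutionsE ?ltW.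
  + move=> i iI x Dx; rewrite solution_formula// ?cbE ?xbE//.
      by case: i iI {Dx} => [|[|[|]]]// _; rewrite ?a1 ?a2; lra.
    by case: i iI {Dx} => [|[|[|]]]// _; rewrite ?a1 ?a2; lra.
Qed.
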